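(* Let $\zeta>0$. For all sufficiently large $m,n$, the one-hexagon Hamiltonian $$H=\sum_{v} h_v+\sum_{P} h_{P}$$ on the $m\times n$ honeycomb torus, where the first sum runs over all vertices and the second over all hexagons, has as its ground space (equal to its kernel) the span of the nine states $$|\Psi_{\nu_h,\nu_v}\rangle=\sum_{L\in\mathcal L}\omega^{\nu_hN_h(L)+\nu_vN_v(L)}\,\zeta^{N^A_{222}(L)+N^B_{111}(L)}\,|L\rangle ,\qquad \nu_h,\nu_v\in\{0,1,2\},\ \omega=e^{2\pi i/3},$$ together with the six states $|C\rangle$, where $C$ ranges over the six crystalline configurations; these are exactly six additional ground states, i.e. the ground space has dimension $15$. Equivalently, no crystalline configuration can be changed by any one-hexagon move, while any two non-crystalline configurations in $\mathcal L$ with the same values of $(N_h,N_v)$ can be transformed into each other by a sequence of one-hexagon moves.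
   Context: Torus. The hexagons (plaquettes) of the honeycomb lattice on the $m\times n$ torus are labelled by $p\in\mathbb Z_m\times\mathbb Z_n$; with $a_1=(1,0)$, $a_2=(0,1)$, two hexagons are adjacent iff they differ by $\pm a_1$, $\pm a_2$ or $\pm(a_1-a_2)$. The vertices of the honeycomb lattice are the $A$ vertices, one for each triple of hexagons $\{p,p+a_1,p+a_2\}$, and the $B$ vertices, one for each triple $\{p+a_1,p+a_2,p+a_1+a_2\}$. The edges of the honeycomb lattice are the pairs of adjacent hexagons (the edge separating them); an edge is incident to a vertex iff both its hexagons belong to the vertex's triple, so each edge joins one $A$ and one $B$ vertex and each vertex has three incident edges. An edge belongs to a hexagon if the hexagon is one of its two hexagons; a hexagon has six edges and six vertices. Hilbert space. Each edge carries $\mathbb C^3$ with orthonormal basis labelled by $\mathbb Z_3=\{0,1,2\}$; the total space is the tensor product over edges, with basis $|L\rangle$, $L$ a map from edges to $\mathbb Z_3$. A vertex configuration (values of the three incident edges) is allowed if the three values sum to $0$ in $\mathbb Z_3$ and are not all equal to $0$. $\mathcal L$ is the set of loop configurations, i.e. of all $L$ for which every vertex configuration is allowed. $N^A_{222}(L)$ (resp. $N^B_{111}(L)$) is the number of $A$ vertices all of whose edges have value $2$ (resp. $B$ vertices all of whose edges have value $1$). $N_h(L)\in\mathbb Z_3$ is the sum of the values of the edges $\{(i,0),(i+1,0)\}$, $i\in\mathbb Z_m$, and $N_v(L)\in\mathbb Z_3$ the sum of the values of the edges $\{(0,j),(0,j+1)\}$, $j\in\mathbb Z_n$. Hamiltonian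 terms. $h_v$ is the orthogonal projector acting on the three edges at $v$ whose kernel is spanned by the allowed vertex configurations. For a hexagon $P$, $h_P$ acts on the six edges of $P$. Each of the six vertices of $P$ has exactly one further incident edge (outer leg). For $r\in\mathbb Z_3^6$ (values of the outer legs) let $X_r$ be the set of assignments $x$ of $\mathbb Z_3$ values to the six edges such that, together with $r$, all six vertex configurations are allowed, and let $w(x)=\zeta^{k}$, where $k$ is the number of $A$ vertices in configuration $222$ plus the number of $B$ vertices in configuration $111$ among these six vertices. Let $|\chi_r\rangle$ be the normalization of $\sum_{x\in X_r}w(x)|x\rangle$ (for $X_r\neq\emptyset$). Then $h_P=\mathbb 1-\sum_{r:X_r\ne\emptyset}|\chi_r\rangle\langle\chi_r|$. A one-hexagon move replaces $L\in\mathcal L$ by some $L'\in\mathcal L$ that differs from $L$ only on the six edges of a single hexagon. Crystalline configurations. There are three types of edges: $\{p,p+a_1\}$, $\{p,p+a_2\}$, and $\{p+a_1,p+a_2\}$. A crystalline configuration is one in which all edges of the same type carry the same value, and the values on the three types are $0,1,2$ in some order (six configurations). In terms of $\mathbb Z_3$ heights on hexagons whose differences give the link variables, these are the stripe patterns: rows of hexagons with constant height along one of the three lattice directions, with the heights of consecutive rows running periodically through $0,1,2$ or through $0,2,1$. *)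

(* Defs.v *)
From HB Require Import structures.
From mathcomp Require Import all_boot all_order all_algebra.
From mathcomp Require Import reals trigo.
From mathcomp Require Export complex.

Set Implicit Arguments.
Unset Strict Implicit.
Unset Printing Implicit Defensive.

Import Order.TTheory GRing.Theory Num.Theory.
Local Open Scope ring_scope.
Local Open Scope complex_scope.

(* The Hilbert space with orthonormal basis [T]. *)
Definition state (R : realType) (T : finType) := {ffun T -> R[i]^o}.

Definition ket (R : realType) (T : finType) (x : T) : state R T :=
  [ffun y => (y == x)%:R].

Definition inner (R : realType) (T : finType) (phi psi : state R T) : R[i] :=
  \sum_x Num.conj (phi x) * psi x.

Definition normalize (R : realType) (T : finType) (phi : state R T) :
    state R T :=
  (sqrtC (inner phi phi))^-1 *: phi.

Definition ketbra_fun (R : realType) (T : finType) (phi psi : state R T) :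
    state R T :=
  inner phi psi *: phi.

Fact ketbra_is_linear (R : realType) (T : finType) (phi : state R T) :
  linear (ketbra_fun phi).
Proof.
move=> a u v; rewrite /ketbra_fun scalerA -scalerDl; congr (_ *: _).
rewrite /inner mulr_sumr -big_split /=; apply: eq_bigr => x _.
by rewrite !ffunE /= mulrDr mulrCA.
Qed.

HB.instance Definition _ (R : realType) (T : finType) (phi : state R T) :=
  GRing.isLinear.Build R[i] (state R T) (state R T) _ (ketbra_fun phi)
    (ketbra_is_linear phi).

Definition ketbra (R : realType) (T : finType) (phi : state R T) :
    'End(state R T) :=
  linfun (ketbra_fun phi).

(* [U] is the eigenspace of the least eigenvalue of [H].  The order of [R[i]]
   is partial, so the least eigenvalue is in particular comparable to all
   eigenvalues. *)
Definition is_ground_space (R : realType) (T : finType)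
    (H : 'End(state R T)) (U : {vspace state R T}) : Prop :=
  exists E : R[i], [/\ passmx.leigenvalue H E,
                       forall a, passmx.leigenvalue H a -> E <= a
                     & U = passmx.leigenspace H E].

(* Assignments of Z_3 values to the elements of [S]; they label the basis of
   the tensor product of the factors C^3 located on [S]. *)
Definition asg (E : finType) (S : {set E}) := {ffun {e : E | e \in S} -> 'Z_3}.

Definition restr (E : finType) (S : {set E}) (L : {ffun E -> 'Z_3}) : asg S :=
  [ffun e => L (val e)].

(* [L] with its values on [S] replaced by those of [x]. *)
Definition patch (E : finType) (S : {set E}) (x : asg S)
    (L : {ffun E -> 'Z_3}) : {ffun E -> 'Z_3} :=
  [ffun e => if insub e is Some e' then x e' else L e].

(* [A] tensored with the identity on the factors outside of [S]: it acts on
   the dependence of [psi] on the values in [S], the other values being kept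
   fixed. *)
Definition embed_fun (R : realType) (E : finType) (S : {set E})
    (A : 'End(state R (asg S))) (psi : state R {ffun E -> 'Z_3}) :
    state R {ffun E -> 'Z_3} :=
  [ffun L => A [ffun x => psi (patch x L)] (restr S L)].

Fact embed_is_linear (R : realType) (E : finType) (S : {set E})
    (A : 'End(state R (asg S))) : linear (embed_fun A).
Proof.
move=> a u v; apply/ffunP => L; rewrite !ffunE /=.
have -> : [ffun x : asg S => (a *: u + v) (patch x L)] =
    a *: ([ffun x => u (patch x L)] : state R (asg S)) +
    ([ffun x => v (patch x L)] : state R (asg S)).
  by apply/ffunP => x; rewrite !ffunE.
by rewrite linearP /= !ffunE.
Qed.

HB.instance Definition _ (R : realType) (E : finType) (S : {set E})
    (A : 'End(state R (asg S))) :=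
  GRing.isLinear.Build R[i] (state R {ffun E -> 'Z_3})
    (state R {ffun E -> 'Z_3}) _ (embed_fun A) (embed_is_linear A).

Definition embed (R : realType) (E : finType) (S : {set E})
    (A : 'End(state R (asg S))) : 'End(state R {ffun E -> 'Z_3}) :=
  linfun (embed_fun A).

(* ['Z_m] is the ring of integers mod [m] only for [1 < m]; everything below
   is meant for large [m] and [n]. *)
Definition hexagon (m n : nat) := ('Z_m * 'Z_n)%type.

Definition a1 (m n : nat) : hexagon m n := (1, 0).
Definition a2 (m n : nat) : hexagon m n := (0, 1).
Arguments a1 {m n}.
Arguments a2 {m n}.

Definition adjacent (m n : nat) (p q : hexagon m n) : bool :=
  (q - p) \in [:: a1; - a1; a2; - a2; a1 - a2; - (a1 - a2)].

Definition is_edge (m n : nat) (e : {set hexagon m n}) : bool :=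
  [exists p : hexagon m n, exists q : hexagon m n,
     adjacent p q && (e == [set p; q])].

Definition edge (m n : nat) := {e : {set hexagon m n} | is_edge e}.

(* [inl p] is the A vertex and [inr p] the B vertex labelled by [p]. *)
Definition vertex (m n : nat) := (hexagon m n + hexagon m n)%type.

Definition triple (m n : nat) (v : vertex m n) : {set hexagon m n} :=
  match v with
  | inl p => [set p; p + a1; p + a2]
  | inr p => [set p + a1; p + a2; p + a1 + a2]
  end.

Definition star (m n : nat) (v : vertex m n) : {set edge m n} :=
  [set e : edge m n | val e \subset triple v].

Definition hex_edges (m n : nat) (P : hexagon m n) : {set edge m n} :=
  [set e : edge m n | P \in val e].

Definition hex_vertices (m n : nat) (P : hexagon m n) : {set vertex m n} :=
  [set v : vertex m n | P \in triple v].

Definition outer_legs (m n : nat) (P : hexagon m n) : {set edge m n} :=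
  [set e : edge m n | (e \notin hex_edges P) &&
                      [exists v in hex_vertices P, e \in star v]].

Definition config (m n : nat) := {ffun edge m n -> 'Z_3}.

Definition allowed (m n : nat) (v : vertex m n) (x : asg (star v)) : bool :=
  (\sum_e x e == 0) && ~~ [forall e, x e == 0].

(* An A vertex in configuration 222 or a B vertex in configuration 111. *)
Definition weighted (m n : nat) (v : vertex m n) (x : asg (star v)) : bool :=
  [forall e, x e == (if v is inl _ then 2 else 1)].

Definition loops (m n : nat) : {set config m n} :=
  [set L : config m n | [forall v : vertex m n, allowed (restr (star v) L)]].

Definition NA222 (m n : nat) (L : config m n) : nat :=
  #|[set p : hexagon m n |
       [forall e in star (inl p : vertex m n), L e == 2]]|.

Definition NB111 (m n : nat) (L : config m n) : nat :=
  #|[set p : hexagon m n |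
       [forall e in star (inr p : vertex m n), L e == 1]]|.

Definition Nh (m n : nat) (L : config m n) : 'Z_3 :=
  \sum_(e : edge m n |
      [exists i : 'Z_m, val e == [set (i, 0); (i + 1, 0)]]) L e.

Definition Nv (m n : nat) (L : config m n) : 'Z_3 :=
  \sum_(e : edge m n |
      [exists j : 'Z_n, val e == [set (0, j); (0, j + 1)]]) L e.

Definition one_hexagon_move (m n : nat) : rel (config m n) :=
  fun L L' => [&& L \in loops m n, L' \in loops m n &
    [exists P : hexagon m n, forall e : edge m n,
       (e \notin hex_edges P) ==> (L' e == L e)]].

Definition edge_type (m n : nat) (t : 'I_3) : {set edge m n} :=
  [set e : edge m n | [exists p : hexagon m n,
     val e == tnth [tuple [set p; p + a1]; [set p; p + a2];
                          [set p + a1; p + a2]] t]].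

Definition crystals (m n : nat) : {set config m n} :=
  [set C : config m n | [exists s : {ffun 'I_3 -> 'Z_3}, injectiveb s &&
     [forall t : 'I_3, forall e in edge_type m n t, C e == s t]]].

Definition h_vertex (R : realType) (m n : nat) (v : vertex m n) :
    'End(state R (config m n)) :=
  embed (\1 - \sum_(x : asg (star v) | allowed x) ketbra (ket R x))%VF.

(* The values [x] on the hexagon and [r] on the outer legs; the values on the
   other edges are irrelevant. *)
Definition join_legs (m n : nat) (P : hexagon m n) (r : asg (outer_legs P))
    (x : asg (hex_edges P)) : config m n :=
  patch x (patch r [ffun=> 0]).

Definition Xset (m n : nat) (P : hexagon m n) (r : asg (outer_legs P)) :
    {set asg (hex_edges P)} :=
  [set x : asg (hex_edges P) |
     [forall v in hex_vertices P, allowed (restr (star v) (join_legs r x))]].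

Definition hex_weight (R : realType) (zeta : R) (m n : nat) (P : hexagon m n)
    (r : asg (outer_legs P)) (x : asg (hex_edges P)) : R[i] :=
  zeta%:C ^+ #|[set v in hex_vertices P |
                  weighted (restr (star v) (join_legs r x))]|.

Definition chi (R : realType) (zeta : R) (m n : nat) (P : hexagon m n)
    (r : asg (outer_legs P)) : state R (asg (hex_edges P)) :=
  normalize (\sum_(x in Xset r) hex_weight zeta r x *: ket R x).

Definition h_hexagon (R : realType) (zeta : R) (m n : nat) (P : hexagon m n) :
    'End(state R (config m n)) :=
  embed (\1 - \sum_(r : asg (outer_legs P) | Xset r != set0)
                ketbra (chi zeta r))%VF.

Definition hamiltonian (R : realType) (zeta : R) (m n : nat) :
    'End(state R (config m n)) :=
  \sum_(v : vertex m n) h_vertex R v + \sum_(P : hexagon m n) h_hexagon zeta P.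

Definition omega (R : realType) : R[i] :=
  cos (2 * pi / 3) +i* sin (2 * pi / 3).

Definition Psi (R : realType) (zeta : R) (m n : nat) (nuh nuv : 'I_3) :
    state R (config m n) :=
  \sum_(L in loops m n)
    (omega R ^+ (nuh * Nh L + nuv * Nv L)%N *
     zeta%:C ^+ (NA222 L + NB111 L)%N) *: ket R L.

Definition Psi_states (R : realType) (zeta : R) (m n : nat) :
    seq (state R (config m n)) :=
  [seq Psi zeta m n nuh nuv | nuh <- enum 'I_3, nuv <- enum 'I_3].

Definition crystal_states (R : realType) (m n : nat) :
    seq (state R (config m n)) :=
  [seq ket R C | C <- enum (crystals m n)].

(* Main.v *)
Require Import Defs.
From HB Require Import structures.
From mathcomp Require Import all_boot all_order all_algebra.
From mathcomp Require Import reals trigo.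
From mathcomp Require boolp.
From mathcomp Require Import zify ring lra.

Set Implicit Arguments.
Unset Strict Implicit.
Unset Printing Implicit Defensive.

Import Order.TTheory GRing.Theory Num.Theory.
Local Open Scope ring_scope.

(** The edge values of a loop configuration are the differences of a Z_3 height
    on the hexagons, defined up to the fluxes around the torus; a vertex is
    allowed iff its three heights are not all equal, and a one-hexagon move
    changes a single height.

    Connectivity has two steps.  First minimize, over a connected component,
    the number of horizontal pairs of equal heights.  At the minimum, a site
    equal to one of its horizontal neighbors cannot be recolored to a color
    different from both of them, so the two sites above it or the two sites
    below it have that color.  The left end of a horizontal run then forces a
    line of left ends, and along such a line one or two moves of total cost
    zero always free a left end.  Hence equal horizontal neighbors exist only if
    a whole row is constant, and then the configuration is crystalline.
    Otherwise neighbors in a row always differ, so the triangles impose no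
    condition between different rows.  A row with a local extremum
    (equal left and right neighbors) is flexible enough to let the next row be
    changed site by site: the pattern abca becomes acba once a common neighbor
    of b and c has been recolored suitably.  Starting from one such row all
    rows can be brought to a normal form; without one, either some
    abca can be changed at once or the configuration is crystalline.

    The Hamiltonian is a sum of embedded projectors, so its kernel is the
    intersection of their kernels: the states supported on loop configurations
    whose quotient by the weight is invariant under moves.  This quotient is
    arbitrary on each crystalline configuration and on each of the nine flux
    sectors, and a discrete Fourier transform on Z_3 x Z_3 gives the Psi. *)

(** * The three edge types *)

Definition t0 : 'I_3 := Ordinal (isT : (0 < 3)%N).
Definition t1 : 'I_3 := Ordinal (isT : (1 < 3)%N).
Definition t2 : 'I_3 := Ordinal (isT : (2 < 3)%N).

Lemma I3_cases (t : 'I_3) : [\/ t = t0, t = t1 | t = t2].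
Proof.
by case: t => [[|[|[|//]]] i];
  [apply: Or31 | apply: Or32 | apply: Or33]; apply/val_inj.
Qed.

Lemma sum3 (V : nmodType) (F : 'I_3 -> V) : \sum_t F t = F t0 + F t1 + F t2.
Proof.
rewrite !big_ord_recl big_ord0 addr0 addrA /=.
by congr (F _ + F _ + F _); apply/val_inj.
Qed.

Lemma all3 (F : pred 'I_3) : [forall t, F t] = [&& F t0, F t1 & F t2].
Proof.
apply/forallP/and3P => [h|[h0 h1 h2] t]; first by split; apply: h.
by case: (I3_cases t) => ->.
Qed.

(** * Left ends of monochromatic runs *)

Lemma Z3_cases (c : 'Z_3) : [\/ c = 0, c = 1 | c = -1].
Proof.
by case: c => [[|[|[|]]] //] i;
  [apply: Or31 | apply: Or32 | apply: Or33]; apply/val_inj.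
Qed.

Lemma Z3_third (a b c d : 'Z_3) :
  a != b -> c != a -> c != b -> d != a -> d != b -> c = d.
Proof.
by case: (Z3_cases a) => ->; case: (Z3_cases b) => ->;
  case: (Z3_cases c) => ->; case: (Z3_cases d) => ->.
Qed.

Lemma Z3_avoid2 (a b : 'Z_3) : exists2 c, c != a & c != b.
Proof.
case: (Z3_cases a) => ->; case: (Z3_cases b) => ->;
  by [exists 0 | exists 1 | exists (-1)].
Qed.

(* Recoloring a site to [c] creates no monochromatic triangle; the arguments
   are the colors of the six neighbors in cyclic order. *)
Definition recolorable (c w ul ur e dr dl : 'Z_3) : bool :=
  [&& ~~ ((w == c) && (ul == c)), ~~ ((ul == c) && (ur == c)),
      ~~ ((ur == c) && (e == c)), ~~ ((e == c) && (dr == c)),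
      ~~ ((dr == c) && (dl == c)) & ~~ ((dl == c) && (w == c))].

Section Window.

(* A window of a coloring, in a frame where the upper neighbors of [(i, j)]
   are [(i, j+1)] and [(i+1, j+1)] and the lower ones [(i-1, j-1)] and
   [(i, j-1)].  [M k H]: [H] is seen in a coloring of the connected component
   whose number of monochromatic horizontal edges exceeds the minimum by
   [k]. *)
Variable M : int -> (nat -> nat -> 'Z_3) -> Prop.
Variable b : nat.
Hypothesis M_ge0 : forall k H, M k H -> 0 <= k.
Hypothesis M_triangle : forall k H i j, M k H ->
  ~~ ((H i.+1 j == H i j) && (H i.+1 j.+1 == H i j)).
Hypothesis M_recolor : forall k H i j c, M k H -> (i.+1 < b)%N -> (j.+1 < b)%N ->
  recolorable c (H i j.+1) (H i.+1 j.+2) (H i.+2 j.+2) (H i.+2 j.+1)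
    (H i.+1 j) (H i j) ->
  exists H', [/\ M (k + ((c == H i j.+1) + (c == H i.+2 j.+1))%N%:Z
                      - ((H i.+1 j.+1 == H i j.+1)
                         + (H i.+1 j.+1 == H i.+2 j.+1))%N%:Z) H',
    H' i.+1 j.+1 = c &
    forall i' j', (i' < b)%N -> (j' < b)%N -> (i' != i.+1) || (j' != j.+1) ->
      H' i' j' = H i' j'].

(** Recoloring to [d] would create no equal horizontal pair and destroy at least one, against
    [M_ge0]. Both horizontal neighbors differ from [d], so only the two upper or the two lower
    neighbors can forbid it. *)
Lemma min_blocked H i j d : M 0 H -> (i.+1 < b)%N -> (j.+1 < b)%N ->
  (H i.+1 j.+1 == H i j.+1) || (H i.+1 j.+1 == H i.+2 j.+1) ->
  d != H i j.+1 -> d != H i.+2 j.+1 ->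
  (H i.+1 j.+2 = d /\ H i.+2 j.+2 = d) \/ (H i j = d /\ H i.+1 j = d).
Proof.
move=> MH ib jb mono dW dE.
have [/andP[/eqP-> /eqP->]|nu] :=
  boolP ((H i.+1 j.+2 == d) && (H i.+2 j.+2 == d)); first by left.
have [/andP[/eqP-> /eqP->]|nd] := boolP ((H i j == d) && (H i.+1 j == d)).
  by right.
have [] := @M_recolor _ _ i j d MH ib jb.
  rewrite eq_sym in dW; rewrite eq_sym in dE.
  by rewrite /recolorable (negPf dW) (negPf dE) !andbF nu /= (andbC (H i.+1 j == d)) nd.
move=> H' [/M_ge0 + _ _]; rewrite (negPf dW) (negPf dE).
by move: mono; do 2!case: (_ == _).
Qed.

(** The left end of a run sits in column 2 and is blocked from above by the third color. Its first
    upper neighbor is again in column 2 of the frame, so successive left ends form a vertical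
    line. *)
Definition left_end (H : nat -> nat -> 'Z_3) j :=
  [&& H 1%N j != H 2%N j, H 3%N j == H 2%N j, H 2%N j.+1 == H 3%N j.+1,
      H 2%N j.+1 != H 1%N j & H 2%N j.+1 != H 2%N j].

(** The blocking pair is itself an equal pair, and its first site cannot be blocked from below,
    where [H 1 j] and [H 2 j] differ. Were it not a left end, each of these two colors would have to
    fill the pair above it. *)
Lemma left_end_up H j : M 0 H -> (2 < b)%N -> (j.+1 < b)%N ->
  left_end H j -> left_end H j.+1.
Proof.
move=> MH b2 jb /and5P[n12 e3 /eqP e3' n1 n2].
have mono : (H 2%N j.+1 == H 1%N j.+1) || (H 2%N j.+1 == H 3%N j.+1).
  by rewrite -e3' eqxx orbT.
have blk d : d != H 1%N j.+1 -> d != H 3%N j.+1 ->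
    H 2%N j.+2 = d /\ H 3%N j.+2 = d.
  move=> d1 d3; have [//|[e1 e2]] := min_blocked MH b2 jb mono d1 d3.
  by move: n12; rewrite e1 e2 eqxx.
have n12' : H 1%N j.+1 != H 2%N j.+1.
  apply/eqP => e12.
  have [||x1 _] := blk (H 1%N j); [by rewrite e12 eq_sym|by rewrite -e3' eq_sym|].
  have [||x2 _] := blk (H 2%N j); [by rewrite e12 eq_sym|by rewrite -e3' eq_sym|].
  by move: n12; rewrite -x1 -x2 eqxx.
have [d d1 d2] := Z3_avoid2 (H 1%N j.+1) (H 3%N j.+1).
have [u1 u2] := blk _ d1 d2.
by rewrite /left_end n12' -e3' eqxx u1 u2 eqxx d1 e3' d2.
Qed.

(* Recoloring the left end [j.+2] unblocks the left end [j.+1]. *)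
Lemma left_end_shift H j : M 0 H -> (3 < b)%N -> (j.+3 < b)%N ->
  left_end H j -> left_end H j.+1 -> left_end H j.+2 ->
  H 1%N j.+1 = H 1%N j.+2.
Proof.
move=> MH b3 jb /and5P[a0 _ _ _ _] /and5P[a1 /eqP e1 /eqP u1 v1 w1].
move=> /and5P[a2 /eqP e2 /eqP u2 v2 w2].
apply/eqP/contraT => nW.
have [|||H' [M' h0 h]] := @M_recolor _ _ 1%N j.+1 (H 1%N j.+2) MH.
- by clear -b3 jb; clear -b3 jb; lia.
- by clear -b3 jb; clear -b3 jb; lia.
- rewrite /recolorable e2 -u2 (eq_sym (H 2%N j.+2)) (negPf a2) (negPf v2).
  by rewrite (negPf nW) !andbF.
have M0 : M 0 H'.
  by move: M'; rewrite e2 !eqxx (eq_sym (H 2%N j.+2)) (negPf a2) /= subrr.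
have [|||||[]|[]] := @min_blocked H' 1%N j (H 2%N j.+2) M0.
- by clear -b3 jb; clear -b3 jb; lia.
- by clear -b3 jb; clear -b3 jb; lia.
- by rewrite !h //= ?e1 ?eqxx ?orbT //; clear -b3 jb; lia.
- by rewrite !h //=; clear -b3 jb; lia.
- by rewrite !h //= ?e1 //; clear -b3 jb; lia.
- by rewrite h0 => E; move: a2; rewrite E eqxx.
- by rewrite !h //=; [move=> E1 E2; move: a0; rewrite E1 E2 eqxx|clear -b3 jb; lia..].
Qed.

(* Otherwise recoloring the left neighbor [(1, j+1)] of the left end to
   [H 2 j.+2] costs nothing and unblocks that left end. *)
Lemma left_end_stripe H j e : M 0 H -> (3 < b)%N -> (j.+3 < b)%N ->
  left_end H j -> left_end H j.+1 ->
  H 1%N j = e -> H 1%N j.+1 = e -> H 1%N j.+2 = e ->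
  H 2%N j = H 2%N j.+2 -> H 0%N j.+1 <> H 2%N j.+1.
Proof.
move=> MH b3 jb /and5P[a0 _ /eqP u0 v0 w0] /and5P[a1 /eqP e1 /eqP u1 v1 w1].
move=> W0 W1 W2 cc y.
rewrite W0 W1 in a0 v0 a1 v1 *.
have ne2 : (e == H 2%N j.+2) = false by rewrite eq_sym (negPf v1).
have [|||H' [M' h0 h]] := @M_recolor _ _ 0%N j (H 2%N j.+2) MH.
- by clear -b3 jb; clear -b3 jb; lia.
- by clear -b3 jb; clear -b3 jb; lia.
- rewrite /recolorable W0 W2 ne2 y (eq_sym (H 2%N j.+1)) (negPf w1).
  by rewrite !andbF.
have M0 : M 0 H'.
  by move: M'; rewrite y W1 (negPf w1) (negPf a1) /= subrr.
have [|||||[]|[]] := @min_blocked H' 1%N j e M0.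
- by clear -b3 jb; clear -b3 jb; lia.
- by clear -b3 jb; clear -b3 jb; lia.
- by apply/orP; right; rewrite !h //= ?e1 ?eqxx //; clear -b3 jb; lia.
- by rewrite h0 ne2.
- by rewrite !h //= ?e1 ?a1 //; clear -b3 jb; lia.
- by rewrite !h //=; [move=> E; move: ne2; rewrite E eqxx|clear -b3 jb; lia..].
- by rewrite !h //=; [move=> _ E; move: a0; rewrite E eqxx|clear -b3 jb; lia..].
Qed.

(** Five successive left ends force stripes: column 1 is constantly [e] in rows 2 to 5, while
    columns 0 and 2 alternate between the two other colors, out of phase. Two moves of cost +1 and
    -1 then unblock a left end. *)
Lemma no_left_end H : (7 < b)%N -> M 0 H -> ~~ left_end H 1.
Proof.
move=> b7 MH; apply/negP => l1.
have b3 : (3 < b)%N by apply: leq_trans b7.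
have b5 : (5 < b)%N by apply: leq_trans b7.
have b6 : (6 < b)%N by apply: leq_trans b7.
have up j : (j < 6)%N -> left_end H j -> left_end H j.+1.
  move=> j6; apply: left_end_up => //; first exact: leq_trans b7.
  by move: b7 j6; clear; lia.
have l2 := up 1%N isT l1; have l3 := up 2%N isT l2; have l4 := up 3%N isT l3.
have l5 := up 4%N isT l4.
have sh j : (j < 5)%N -> left_end H j -> left_end H j.+1 -> left_end H j.+2 ->
    H 1%N j.+2 = H 1%N j.+1.
  by move=> j5 *; symmetry; apply: left_end_shift => //; move: b7 j5; clear; lia.
have W3 := sh 1%N isT l1 l2 l3; have W4 := sh 2%N isT l2 l3 l4.
have W5 := sh 3%N isT l3 l4 l5.
move: (l2) (l3) (l4) => /and5P[a2 /eqP e2 /eqP u2 v2 w2].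
move=> /and5P[a3 /eqP e3 /eqP u3 v3 w3] /and5P[a4 /eqP e4 /eqP u4 v4 w4].
set e := H 1%N 2%N in W3 *.
rewrite W3 -/e in W4; rewrite W4 in W5.
rewrite W3 in a3 v3; rewrite W4 in a4 v4.
have c24 : H 2%N 2%N = H 2%N 4%N.
  by apply: (Z3_third a3); rewrite // eq_sym.
have c35 : H 2%N 3%N = H 2%N 5%N.
  by apply: (Z3_third a4); rewrite // eq_sym.
have y3 : H 0%N 3%N <> H 2%N 3%N by apply: (@left_end_stripe H 2 e).
have y4 : H 0%N 4%N <> H 2%N 4%N by apply: (@left_end_stripe H 3 e).
have ye j : (j < 6)%N -> H 1%N j = e -> H 1%N j.+1 = e -> H 0%N j != e.
  move=> _ E1 E2; have := M_triangle 0 j MH; rewrite E1 E2 eq_sym.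
  by case: (_ == _).
have ne (x y : 'Z_3) : x <> y -> x != y by move/eqP.
have y3' : H 0%N 3%N = H 2%N 4%N.
  by apply: (Z3_third a3); [apply: ye|apply: ne| |].
have y4' : H 0%N 4%N = H 2%N 3%N.
  by apply: (Z3_third a4); [apply: ye|apply: ne|rewrite eq_sym|rewrite eq_sym].
set c := H 2%N 4%N in c24 y3' *; set f := H 2%N 3%N in c35 y4' *.
have ef : (e == f) = false by apply: negPf.
have ec : (e == c) = false by apply: negPf.
have cf : (c == f) = false by apply: negPf.
have fc : (f == c) = false by rewrite eq_sym.
have fe : (f == e) = false by rewrite eq_sym.
have ce : (c == e) = false by rewrite eq_sym.
have neq := (ef, ec, cf, fc, fe, ce).
(* First move: in row 4 the site left of the left end takes the color [f] of its own left neighbor,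
   at cost 1. *)
have [|||H1 [M1 h1 H1E]] := @M_recolor _ _ 0%N 3%N f MH.
- by clear -b7; lia.
- by clear -b7; lia.
- by rewrite /recolorable y4' W5 -c35 W3 y3' -/c !neq !andbF.
have {}M1 : M 1 H1.
  by move: M1; rewrite y4' W4 -/c eqxx !neq.
have h31 : H1 2%N 3%N = f by rewrite H1E //; clear -b7; lia.
have h32 : H1 3%N 3%N = f by rewrite H1E ?e3 //; clear -b7; lia.
have h30 : H1 1%N 3%N = e by rewrite H1E ?W3 //; clear -b7; lia.
have h51 : H1 2%N 5%N = f by rewrite H1E -?c35 //; clear -b7; lia.
have h52 : H1 3%N 5%N = f by rewrite H1E -?u4 -?c35 //; clear -b7; lia.
have h41 : H1 2%N 4%N = c by rewrite H1E //; clear -b7; lia.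
have h42 : H1 3%N 4%N = c by rewrite H1E ?e4 //; clear -b7; lia.
have h20 : H1 1%N 2%N = e by rewrite H1E //; clear -b7; lia.
(* Second move: the left end of row 4 passes from [c] to [e], which destroys one equal pair and
   returns to the minimum. *)
have [|||H2 [M2 h2 H2E]] := @M_recolor _ _ 1%N 3%N e M1.
- by clear -b7; lia.
- by clear -b7; lia.
- by rewrite /recolorable h1 h51 h52 h42 h31 h30 !neq !andbF.
have {}M2 : M 0 H2.
  by move: M2; rewrite h1 h42 h41 eqxx !neq.
(* The left end of row 3 could now take [c]: both the upper pair and the lower pair contain an
   [e]. *)
have [|||||[+ _]|[+ _]] := @min_blocked H2 1%N 2%N c M2.
- by clear -b7; lia.
- by clear -b7; lia.
- by rewrite !H2E ?h31 ?h32 ?eqxx ?orbT //; clear -b7; lia.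
- by rewrite H2E ?h30 ?ce //; clear -b7; lia.
- by rewrite H2E ?h32 ?cf //; clear -b7; lia.
- by rewrite h2 => /eqP; rewrite ec.
- by rewrite H2E ?h20; [move=> /eqP; rewrite ec|clear -b7; lia..].
Qed.

End Window.

(** * Sums of embedded projectors *)

Section Hilbert.
Local Open Scope complex_scope.
Variable R : realType.
Implicit Type T : finType.

Lemma stateZE T (a : R[i]) (phi : state R T) x : (a *: phi) x = a * phi x.
Proof. by rewrite ffunE. Qed.

Lemma innerDr T (phi u v : state R T) : inner phi (u + v) = inner phi u + inner phi v.
Proof. by rewrite /inner -big_split; apply: eq_bigr => x _; rewrite !ffunE mulrDr. Qed.

Lemma innerZr T (phi u : state R T) a : inner phi (a *: u) = a * inner phi u.
Proof. by rewrite /inner mulr_sumr; apply: eq_bigr => x _;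
  rewrite !ffunE /= mulrCA. Qed.

Lemma innerNr T (phi u : state R T) : inner phi (- u) = - inner phi u.
Proof. by rewrite -scaleN1r innerZr mulN1r. Qed.

Lemma inner0r T (phi : state R T) : inner phi 0 = 0.
Proof. by rewrite -(scale0r 0) innerZr mul0r. Qed.

Lemma inner_sumr T (phi : state R T) (I : finType) (P : pred I) (F : I -> state R T) :
  inner phi (\sum_(i | P i) F i) = \sum_(i | P i) inner phi (F i).
Proof. exact: (big_morph _ (innerDr phi) (inner0r phi)). Qed.

Lemma inner_conj T (phi psi : state R T) : inner psi phi = Num.conj (inner phi psi).
Proof.
rewrite /inner rmorph_sum; apply: eq_bigr => x _.
by rewrite rmorphM /= conjCK mulrC.
Qed.

Lemma innerZl T (phi u : state R T) a : inner (a *: u) phi = Num.conj a * inner u phi.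
Proof. by rewrite inner_conj innerZr rmorphM /= -inner_conj. Qed.

Lemma inner_ge0 T (phi : state R T) : 0 <= inner phi phi.
Proof. by apply: sumr_ge0 => x _; rewrite mulrC mul_conjC_ge0. Qed.

Lemma inner_eq0 T (phi : state R T) : inner phi phi = 0 -> phi = 0.
Proof.
move=> h; apply/ffunP => x; rewrite ffunE; apply/eqP; rewrite -mul_conjC_eq0 mulrC.
by apply/eqP; apply: (psumr_eq0P _ h) => // y _; rewrite mulrC mul_conjC_ge0.
Qed.

Section Projector.
Variables (T I : finType) (P : pred I) (chi : I -> state R T).
Hypothesis ortho : forall i j, P i -> P j -> inner (chi i) (chi j) = (i == j)%:R.

Definition coprojector : 'End(state R T) := (\1 - \sum_(i | P i) ketbra (chi i))%VF.

Lemma coprojectorE phi :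
  coprojector phi = phi - \sum_(i | P i) inner (chi i) phi *: chi i.
Proof.
rewrite /coprojector add_lfunE opp_lfunE id_lfunE sum_lfunE.
by congr (_ - _); apply: eq_bigr => i _; rewrite lfunE.
Qed.

(** The image of [coprojector] is orthogonal to every [chi i], so the subtracted sum contributes
    nothing to the quadratic form. *)
Lemma coprojector_quad phi :
  inner phi (coprojector phi) = inner (coprojector phi) (coprojector phi).
Proof.
have o i : P i -> inner (chi i) (coprojector phi) = 0.
  move=> Pi; rewrite coprojectorE innerDr innerNr inner_sumr (bigD1 i) //=.
  rewrite innerZr ortho // eqxx mulr1 big1 ?addr0 ?subrr // => j /andP[Pj ji].
  by rewrite innerZr ortho // eq_sym (negPf ji) mulr0.
apply/eqP; rewrite -subr_eq0 inner_conj [X in _ - X]inner_conj -rmorphB conjC_eq0.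
rewrite -innerNr -innerDr {2}coprojectorE opprB addrCA subrr addr0.
by rewrite inner_sumr big1 // => i Pi;
  rewrite innerZr [inner (coprojector phi) _]inner_conj o // rmorph0 mulr0.
Qed.

Lemma coprojector_chi i : P i -> coprojector (chi i) = 0.
Proof.
move=> Pi; rewrite coprojectorE (bigD1 i) //= ortho // eqxx scale1r.
rewrite big1 ?addr0 ?subrr // => j /andP[Pj ji].
by rewrite ortho // (negPf ji) scale0r.
Qed.

End Projector.

Section Embed.
Variables (E : finType) (S : {set E}).
Implicit Types (L : {ffun E -> 'Z_3}) (x : asg S).

Lemma patch_in x L (e : {e | e \in S}) : patch x L (val e) = x e.
Proof. by rewrite ffunE valK. Qed.

Lemma patch_out x L e : e \notin S -> patch x L e = L e.
Proof. by move=> eS; rewrite ffunE insubN. Qed.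

Lemma patch_mem x L e (eS : e \in S) : patch x L e = x (exist (fun e => e \in S) e eS).
Proof. exact: (patch_in x L (exist (fun e => e \in S) e eS)). Qed.

Lemma restr_patch x L : restr S (patch x L) = x.
Proof. by apply/ffunP => e; rewrite ffunE patch_in. Qed.

Lemma patch_patch (x y : asg S) L : patch x (patch y L) = patch x L.
Proof.
apply/ffunP => e; case: (boolP (e \in S)) => eS; last by rewrite !patch_out.
by rewrite !(patch_mem _ _ eS).
Qed.

Lemma patch_eq L L' : (forall e, e \notin S -> L' e = L e) -> patch (restr S L') L = L'.
Proof.
move=> h; apply/ffunP => e; case: (boolP (e \in S)) => eS;
  last by rewrite patch_out // h.
by rewrite (patch_mem _ _ eS) ffunE.
Qed.

Lemma patch_restr L : patch (restr S L) L = L.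
Proof. exact: patch_eq. Qed.

Definition slice (psi : state R {ffun E -> 'Z_3}) L : state R (asg S) :=
  [ffun x => psi (patch x L)].

Lemma slice_patch psi x L : slice psi (patch x L) = slice psi L.
Proof. by apply/ffunP => y; rewrite !ffunE patch_patch. Qed.

Variable A : 'End(state R (asg S)).

Lemma embedE psi L : embed A psi L = A (slice psi L) (restr S L).
Proof. by rewrite lfunE ffunE. Qed.

Lemma embed_eq0 psi : embed A psi = 0 <-> forall L, A (slice psi L) = 0.
Proof.
split=> [h L|h]; last by apply/ffunP => L; rewrite embedE h !ffunE.
apply/ffunP => x; have := congr1 (fun f : state R _ => f (patch x L)) h.
by rewrite /= embedE slice_patch restr_patch => ->; rewrite !ffunE.
Qed.

(* Each configuration is a patch of [#|asg S|] configurations. *)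
Lemma sum_patch (F : {ffun E -> 'Z_3} -> R[i]) :
  \sum_L \sum_(x : asg S) F (patch x L) = (\sum_L F L) *+ #|asg S|.
Proof.
rewrite pair_big /= (reindex_inj (h := fun p => (patch p.2 p.1, restr S p.1))) /=;
  last first.
  apply: (can_inj (g := fun p => (patch p.2 p.1, restr S p.1))) => -[L x] /=.
  by rewrite patch_patch restr_patch patch_restr.
under eq_bigr => p _ do rewrite patch_patch patch_restr.
rewrite -(pair_big xpredT xpredT (fun L (x : asg S) => F L)) /= -sumrMnl.
by apply: eq_bigr => L _; rewrite sumr_const.
Qed.

(** All [#|asg S|] configurations that agree off [S] give the same slice, whence the
    multiplicity. *)
Lemma embed_quad psi :
  inner psi (embed A psi) *+ #|asg S| = \sum_L inner (slice psi L) (A (slice psi L)).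
Proof.
rewrite /inner -sum_patch; apply: eq_bigr => L _; apply: eq_bigr => x _.
by rewrite embedE slice_patch restr_patch [slice _ _ x]ffunE.
Qed.

Hypothesis quad : forall phi, inner phi (A phi) = inner (A phi) (A phi).

Lemma card_asg_gt0 : (0 < #|asg S|)%N.
Proof. by apply/card_gt0P; exists [ffun=> 0]. Qed.

Lemma embed_ge0 psi : 0 <= inner psi (embed A psi).
Proof.
rewrite -(pmulrn_lge0 _ card_asg_gt0) embed_quad.
by apply: sumr_ge0 => L _; rewrite quad inner_ge0.
Qed.

Lemma embed_kernel psi : inner psi (embed A psi) = 0 -> embed A psi = 0.
Proof.
move=> h; apply/embed_eq0 => L; apply: inner_eq0; rewrite -quad.
have := embed_quad psi; rewrite h mul0rn => /esym/psumr_eq0P; apply=> //.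
by move=> M _; rewrite quad inner_ge0.
Qed.

End Embed.

(** An eigenvector [psi] for [a] gives [a * inner psi psi = inner psi (H psi)], so no eigenvalue
    lies below 0, and 0 is one because the kernel is nonzero. *)
Lemma psd_ground_space T (H : 'End(state R T)) : lker H != 0%VS ->
  (forall psi, 0 <= inner psi (H psi)) -> is_ground_space H (lker H).
Proof.
move=> k0 Hge0; have e0 : passmx.leigenspace H 0 = lker H.
  by rewrite /passmx.leigenspace scale0r subr0.
have ev0 : passmx.leigenvalue H 0 by rewrite /passmx.leigenvalue e0.
exists 0; split; [exact: ev0| |exact: esym e0].
move=> a; rewrite /passmx.leigenvalue -vpick0; set psi := vpick _ => psi0.
have : psi \in passmx.leigenspace H a by apply: memv_pick.
rewrite memv_ker add_lfunE opp_lfunE scale_lfunE id_lfunE subr_eq0 => /eqP Hpsi.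
have pos : 0 < inner psi psi.
  rewrite lt_neqAle inner_ge0 andbT.
  by apply: contraNneq psi0 => /esym/inner_eq0 ->.
by rewrite -(pmulr_lge0 _ pos) -innerZr -Hpsi; exact: Hge0.
Qed.

End Hilbert.

(** * Fourier transform on Z_3 *)

Section Fourier.
Local Open Scope complex_scope.
Variable R : realType.
Local Notation w := (omega R).

Lemma omega_cube : w ^+ 3 = 1.
Proof.
pose t : R := 2 * pi / 3.
have cis_mul (a b : R) : (cos a +i* sin a) * (cos b +i* sin b) = cos (a + b) +i* sin (a
  + b).
  rewrite cosD sinD; apply/eqP; rewrite eq_complex /= eqxx /=.
  by apply/eqP; exact: addrC.
have cu : w ^+ 3 = cos (t + t + t) +i* sin (t + t + t).
  by rewrite exprSr expr2 /omega -/t !cis_mul.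
rewrite cu (_ : t + t + t = pi *+ 2); last by rewrite /t mulr2n; field.
by rewrite cos2pi sin2pi.
Qed.

Lemma omega_neq1 : w != 1.
Proof.
rewrite /omega eq_complex negb_and /=; apply/orP; right.
rewrite gt_eqF // sin_gt0_pi //; have := pi_gt0 R; lra.
Qed.

Lemma omega_sum : 1 + w + w ^+ 2 = 0.
Proof.
have : (w - 1) * (1 + w + w ^+ 2) = 0.
  have -> : (w - 1) * (1 + w + w ^+ 2) = w ^+ 3 - 1 by ring.
  by rewrite omega_cube subrr.
by move/eqP; rewrite mulf_eq0 subr_eq0 (negPf omega_neq1) /= => /eqP.
Qed.

Lemma omega_mod k : w ^+ k = w ^+ (k %% 3).
Proof. by rewrite {1}(divn_eq k 3) exprD mulnC exprM omega_cube expr1n mul1r. Qed.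

(** Modulo 3 the factor 2 is -1, so the second power is the conjugate character and this is
    orthogonality of characters. *)
Lemma omega_ortho (i j : 'I_3) :
  \sum_(k : 'I_3) w ^+ (k * i) * w ^+ (2 * k * j) = if i == j then 3%:R else 0.
Proof.
have -> : \sum_(k : 'I_3) w ^+ (k * i) * w ^+ (2 * k * j) =
    \sum_(k : 'I_3) (w ^+ ((i + 2 * j) %% 3)) ^+ k.
  apply: eq_bigr => k _; rewrite -omega_mod -exprD -exprM; congr (_ ^+ _).
  by rewrite mulnDl mulnC mulnAC.
rewrite sum3 expr0 expr1.
have w4 : (w ^+ 2) ^+ 2 = w by rewrite -exprM omega_mod expr1.
have s2 : 1 + w ^+ 2 + w = 0 by rewrite addrAC omega_sum.
case: i j => [[|[|[|//]]] ii] [[|[|[|//]]] jj];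
  rewrite [(_ %% _)%N]/= ?expr0 ?expr1 ?expr1n ?w4 ?omega_sum ?s2 //; ring.
Qed.

Definition dft (f : 'I_3 -> R[i]) (k : 'I_3) : R[i] :=
  3%:R^-1 * \sum_(j : 'I_3) w ^+ (2 * k * j) * f j.

Lemma three_neq0 : 3%:R != 0 :> R[i]. Proof. by rewrite pnatr_eq0. Qed.

Lemma dftK f (i : 'I_3) : \sum_k dft f k * w ^+ (k * i) = f i.
Proof.
under eq_bigr => k _ do rewrite mulrAC -mulrA mulr_sumr.
rewrite -mulr_sumr exchange_big /=.
under eq_bigr => j _.
  under eq_bigr => k _ do rewrite mulrA.
  rewrite -mulr_suml omega_ortho; over.
rewrite (bigD1 i) //= eqxx big1 ?addr0 ?mulKf ?three_neq0 // => j ji.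
by rewrite eq_sym (negPf ji) mul0r.
Qed.

Lemma dft_inj (k : 'I_3 -> R[i]) :
  (forall i : 'I_3, \sum_j k j * w ^+ (j * i) = 0) -> forall j, k j = 0.
Proof.
move=> k0 j0; apply: (mulIf three_neq0); rewrite mul0r.
have : \sum_(i : 'I_3) w ^+ (2 * i * j0) * (\sum_j k j * w ^+ (j * i)) = 0.
  by rewrite big1 // => i _; rewrite k0 mulr0.
under eq_bigr => i _ do rewrite mulr_sumr.
rewrite exchange_big /= => <-; rewrite (bigD1 j0) //= [X in _ + X]big1 ?addr0.
  under eq_bigr => i _ do rewrite mulrCA mulrC (mulrC (w ^+ (2 * _ * _))) (mulnC j0).
  by rewrite -mulr_suml omega_ortho eqxx mulrC.
move=> j jj0; under eq_bigr => i _ do rewrite mulrCA mulrC (mulrC (w ^+ (2 * _ * _)))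
  (mulnC j).
by rewrite -mulr_suml omega_ortho (negPf jj0) mul0r.
Qed.

Definition dft2 (f : 'I_3 -> 'I_3 -> R[i]) (k l : 'I_3) : R[i] :=
  dft (fun i => dft (f i) l) k.

Lemma dft2K f (i j : 'I_3) :
  \sum_(k : 'I_3) \sum_(l : 'I_3) dft2 f k l * w ^+ (k * i + l * j) = f i j.
Proof.
rewrite -(dftK (f i) j) exchange_big /=; apply: eq_bigr => l _.
rewrite -(dftK (fun i => dft (f i) l) i) mulr_suml; apply: eq_bigr => k _.
by rewrite exprD mulrA.
Qed.

Lemma dft2_inj (k : 'I_3 -> 'I_3 -> R[i]) :
  (forall i j : 'I_3, \sum_(a : 'I_3) \sum_(b : 'I_3) k a b * w ^+ (a * i + b * j) = 0)
    ->
  forall a b, k a b = 0.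
Proof.
move=> k0 a; apply: dft_inj => j; move: a; apply: dft_inj => i.
rewrite -[RHS](k0 i j); apply: eq_bigr => a _; rewrite mulr_suml.
by apply: eq_bigr => b _; rewrite exprD -mulrA (mulrC (w ^+ (b * j))).
Qed.

End Fourier.

(** Coefficients are indexed by labels rather than by list positions, which suits a family of states
    given by two kinds of labels. *)
Lemma free_map (K : fieldType) (V : vectType K) (I : eqType) (s : seq I) (F : I -> V) :
  uniq s -> (forall k : I -> K, \sum_(i <- s) k i *: F i = 0 -> forall i, i \in s -> k
    i = 0) ->
  free (map F s).
Proof.
move=> us h; rewrite -[map F s]/(tval (in_tuple (map F s))); apply/freeP => k.
rewrite [tval _]/(map F s) => k0.
(* As [s] is duplicate-free, [index] inverts [nth]; the default 0 is the value at labels outside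
   [s]. *)
pose k' i := if insub (index i s) is Some j then k j else 0.
have k'E (j : 'I_(size (map F s))) i0 : k' (nth i0 s j) = k j.
  have js : (j < size s)%N by rewrite -(size_map F).
  by rewrite /k' index_uniq // valK.
move=> j; have [i0 _] : exists i0 : I, i0 \in s.
  by case: (s) j => [[]|i0 s'] // _; exists i0; rewrite mem_head.
have js : (j < size s)%N by rewrite -(size_map F).
rewrite -(k'E j i0); apply: h; last exact: mem_nth.
rewrite -[RHS]k0 (big_nth i0) big_mkord -(size_map F s); apply: eq_bigr => l _.
have ls : (l < size s)%N by rewrite -(size_map F).
by rewrite k'E (nth_map i0).
Qed.

(** * Edges, vertices and heights on the torus *)

Section Torus.
Variables m n : nat.
Hypotheses (m_gt : (20 < m)%N) (n_gt : (20 < n)%N).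

Lemma Zp_int_eq0 (p : nat) (k : int) : (1 < p)%N ->
  (k%:~R == 0 :> 'Z_p) = (p %| k)%Z.
Proof.
move=> p1; have nat0 (i : nat) : (i%:R == 0 :> 'Z_p) = (p %| i)%N.
  by rewrite -val_eqE /= val_Zp_nat.
by case: k => i; rewrite ?NegzE ?mulrNz ?oppr_eq0 nat0.
Qed.

Lemma Zp_int_eq (p : nat) (x y : int) : (1 < p)%N ->
  (x%:~R == y%:~R :> 'Z_p) = (p %| x - y)%Z.
Proof. by move=> p1; rewrite -subr_eq0 -mulrzBr Zp_int_eq0. Qed.

Lemma dvdz_small (p : nat) (k : int) : (20 < p)%N -> `|k| <= 20 ->
  (p %| k)%Z = (k == 0).
Proof.
move=> p20 k20; apply/idP/eqP => [/dvdzP[q kq]|->]; last exact: dvdz0.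
move: k20; rewrite kq normrM; case: (eqVneq q 0) => [->|q0]; first by rewrite mul0r.
have q1 : 1 <= `|q| by lia.
by move=> h; exfalso; nia.
Qed.

(** Matching the endpoints of two edges gives two congruences per coordinate. Their offsets must
    agree, which refutes the wrong matchings whatever the coordinates are. *)
Lemma dvdz_clash (p : nat) (a b : int) : (20 < p)%N ->
  (p %| a)%Z -> (p %| b)%Z -> `|a - b| <= 20 -> a = b.
Proof.
move=> p20 pa pb /(dvdz_small p20); rewrite rpredB // => /esym/eqP.
by move/eqP; rewrite subr_eq0 => /eqP.
Qed.

(** Integer coordinates on the universal cover of the torus. *)
Definition site (x y : int) : hexagon m n := (x%:~R, y%:~R).

Lemma siteP (p : hexagon m n) : exists x y, p = site x y.
Proof.
exists (p.1 : nat)%:Z, (p.2 : nat)%:Z; case: p => u v; congr (_, _).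
  by rewrite -pmulrn natr_Zp.
by rewrite -pmulrn natr_Zp.
Qed.

Lemma site_eq x y x' y' :
  (site x y == site x' y') = (m %| x - x')%Z && (n %| y - y')%Z.
Proof. by rewrite xpair_eqE !Zp_int_eq // (leq_trans _ m_gt, leq_trans _ n_gt). Qed.

Lemma site_small x y x' y' : `|x - x'| <= 20 -> `|y - y'| <= 20 ->
  (site x y == site x' y') = (x == x') && (y == y').
Proof.
by move=> *; rewrite site_eq !dvdz_small // !subr_eq0.
Qed.

Lemma siteD x y u v : site x y + site u v = site (x + u) (y + v).
Proof. by rewrite /site !rmorphD. Qed.

Lemma siteB x y u v : site x y - site u v = site (x - u) (y - v).
Proof. by rewrite /site !rmorphB. Qed.

Lemma a1E : a1 = site 1 0. Proof. by []. Qed.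
Lemma a2E : a2 = site 0 1. Proof. by []. Qed.

Definition siteE := (a1E, a2E, siteD, siteB, addr0, subr0).

Fact edge_subproof (p : hexagon m n) (t : 'I_3) :
  is_edge (tnth [tuple [set p; p + a1]; [set p; p + a2];
                       [set p + a1; p + a2]] t).
Proof.
case: t => [[|[|[|//]]] i]; rewrite (tnth_nth set0) /=; apply/existsP.
- exists p; apply/existsP; exists (p + a1); rewrite eqxx andbT /adjacent.
  by rewrite (addrC p) addrK !inE eqxx.
- exists p; apply/existsP; exists (p + a2); rewrite eqxx andbT /adjacent.
  by rewrite (addrC p) addrK !inE eqxx !orbT.
- exists (p + a1); apply/existsP; exists (p + a2); rewrite eqxx andbT /adjacent.
  by rewrite opprD addrACA subrr add0r opprB (addrC a2) !inE eqxx !orbT.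
Qed.

Definition ed (p : hexagon m n) (t : 'I_3) : edge m n :=
  exist (fun e => is_edge e) _ (edge_subproof p t).

Lemma val_ed0 p : val (ed p t0) = [set p; p + a1]. Proof. by []. Qed.
Lemma val_ed1 p : val (ed p t1) = [set p; p + a2]. Proof. by []. Qed.
Lemma val_ed2 p : val (ed p t2) = [set p + a1; p + a2]. Proof. by []. Qed.
Definition val_ed := (val_ed0, val_ed1, val_ed2).

Lemma ed_surj (e : edge m n) : exists p t, e = ed p t.
Proof.
case: e => e ie; have /existsP[p /existsP[q /andP[adj /eqP eE]]] := ie; subst e.
have {adj} : q - p \in [:: a1; - a1; a2; - a2; a1 - a2; a2 - a1].
  by move: adj; rewrite /adjacent opprB.
have qE c : q - p = c -> q = c + p by move/(canRL (subrK p)).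
rewrite !inE; case/or4P=> [/eqP/qE|/eqP/qE|/eqP/qE|/or3P[]/eqP/qE] {}qE.
- by exists p, t0; apply/val_inj; rewrite val_ed /= qE (addrC p).
- by exists q, t0; apply/val_inj; rewrite val_ed /= qE addrAC addNr add0r setUC.
- by exists p, t1; apply/val_inj; rewrite val_ed /= qE (addrC p).
- by exists q, t1; apply/val_inj; rewrite val_ed /= qE addrAC addNr add0r setUC.
- exists (p - a2), t2; apply/val_inj; rewrite val_ed /= qE subrK setUC.
  by rewrite addrAC [p - a2 + a1]addrAC (addrC p).
- exists (p - a1), t2; apply/val_inj; rewrite val_ed /= qE subrK.
  by rewrite addrAC [p - a1 + a2]addrAC (addrC p).
Qed.

Lemma set2_inj (T : finType) (a b c d : T) :
  [set a; b] = [set c; d] -> a = c /\ b = d \/ a = d /\ b = c.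
Proof.
move/setP => E; have := E a; have := E b; have := E c; have := E d.
rewrite !inE !eqxx ?orbT /= => /orP Ed /orP Ec /esym/orP Eb /esym/orP Ea.
by case: Ea => /eqP Ea; case: Eb => /eqP Eb; case: Ec => /eqP Ec;
  case: Ed => /eqP Ed; subst; auto.
Qed.

Lemma ed_inj p q t s : ed p t = ed q s -> p = q /\ t = s.
Proof.
have [x [y ->]] := siteP p; have [u [v ->]] := siteP q => {p q}.
move=> /(congr1 val).
case: (I3_cases t) => ->; case: (I3_cases s) => ->;
  rewrite !val_ed /= !siteE => /set2_inj[]
 [/eqP + /eqP +]; rewrite !site_eq => /andP[X1 Y1] /andP[X2 Y2];
 have := dvdz_clash m_gt X1 X2; have := dvdz_clash n_gt Y1 Y2 => hy hx.
all: first [ exfalso; lia | split=> // ].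
all: by apply/eqP; rewrite site_eq ?X1 ?X2 ?Y1.
Qed.

(** Offset of the base hexagon of the type [t] edge at a [B] vertex; at an [A] vertex the three
    edges have the same base. *)
Definition shiftB (t : 'I_3) : hexagon m n := [:: a2; a1; 0]`_t.

Lemma shiftB0 : shiftB t0 = a2. Proof. by []. Qed.
Lemma shiftB1 : shiftB t1 = a1. Proof. by []. Qed.
Lemma shiftB2 : shiftB t2 = 0. Proof. by []. Qed.
Definition shiftBE := (shiftB0, shiftB1, shiftB2).

Lemma mem_star_inl q t p : (ed q t \in star (inl p)) = (q == p).
Proof.
rewrite inE; have [x [y ->]] := siteP p; have [u [v ->]] := siteP q => {p q}.
apply/idP/eqP => [|->]; last first.
  by case: (I3_cases t) => ->; rewrite val_ed /= !subUset !sub1set !inE !eqxx ?orbT.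
case: (I3_cases t) => ->; rewrite val_ed /= !siteE !subUset !sub1set !inE !site_eq;
  move=> /andP[/orP[/orP[]|] /andP[X1 Y1] /orP[/orP[]|] /andP[X2 Y2]];
 have := dvdz_clash m_gt X1 X2; have := dvdz_clash n_gt Y1 Y2 => hy hx.
all: try (exfalso; lia).
all: by apply/eqP; rewrite site_eq ?X1 ?X2 ?Y1 ?Y2.
Qed.

Lemma mem_star_inr q t p : (ed q t \in star (inr p)) = (q == p + shiftB t).
Proof.
rewrite inE; have [x [y ->]] := siteP p; have [u [v ->]] := siteP q => {p q}.
apply/idP/eqP => [|->]; last first.
  case: (I3_cases t) => ->; rewrite val_ed /= ?shiftBE !subUset !sub1set !inE.
  - by rewrite addrAC !eqxx ?orbT.
  - by rewrite !eqxx ?orbT.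
  - by rewrite addr0 !eqxx ?orbT.
case: (I3_cases t) => ->; rewrite val_ed /= ?shiftBE ?addr0 !siteE
  !subUset !sub1set !inE !site_eq;
  move=> /andP[/orP[/orP[]|] /andP[X1 Y1] /orP[/orP[]|] /andP[X2 Y2]];
 have := dvdz_clash m_gt X1 X2; have := dvdz_clash n_gt Y1 Y2 => hy hx.
all: try (exfalso; lia).
all: by apply/eqP; rewrite site_eq ?X1 ?X2 ?Y1 ?Y2.
Qed.

(** Inverse of [ed]; the default is never reached because of [ed_surj]. *)
Definition eidx (e : edge m n) : hexagon m n * 'I_3 :=
  odflt (0, t0) [pick pt | ed pt.1 pt.2 == e].

Lemma edK p t : eidx (ed p t) = (p, t).
Proof.
rewrite /eidx; case: pickP => [[q s] /= /eqP/ed_inj[-> ->] //|].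
by move=> /(_ (p, t)); rewrite eqxx.
Qed.

Lemma edge_ind (Q : edge m n -> Prop) : (forall p t, Q (ed p t)) -> forall e, Q e.
Proof. by move=> h e; have [p [t ->]] := ed_surj e. Qed.

Definition conf_of (f : hexagon m n -> 'I_3 -> 'Z_3) : config m n :=
  [ffun e => f (eidx e).1 (eidx e).2].

Lemma conf_ofE f p t : conf_of f (ed p t) = f p t.
Proof. by rewrite ffunE edK. Qed.

Lemma conf_ext (L L' : config m n) :
  (forall p t, L (ed p t) = L' (ed p t)) -> L = L'.
Proof. by move=> h; apply/ffunP; apply: edge_ind. Qed.

Definition vedge (v : vertex m n) (t : 'I_3) : edge m n :=
  match v with inl p => ed p t | inr p => ed (p + shiftB t) t end.

Lemma vedge_inj v : injective (vedge v).
Proof. by case: v => p t s /= /ed_inj[]. Qed.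

Lemma starE v : star v = [set vedge v t | t : 'I_3].
Proof.
apply/setP; apply: edge_ind => q t; apply/idP/imsetP => [|[s _ ->]].
  by case: v => p; rewrite (mem_star_inl, mem_star_inr) => /eqP->; exists t.
by case: v => p /=; rewrite (mem_star_inl, mem_star_inr).
Qed.

Lemma allowedE v (L : config m n) :
  allowed (restr (star v) L) =
    (L (vedge v t0) + L (vedge v t1) + L (vedge v t2) == 0) &&
    ~~ [&& L (vedge v t0) == 0, L (vedge v t1) == 0 & L (vedge v t2) == 0].
Proof.
rewrite /allowed; congr ((_ == 0) && ~~ _).
  under eq_bigr => e _ do rewrite ffunE.
  rewrite -(big_sub (star v) L) /= starE big_imset /=;
    last by move=> ? ? _ _ /vedge_inj.
  exact: sum3.
rewrite -(all3 (fun t => L (vedge v t) == 0)).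
apply/forallP/forallP => h => [t|e].
  have it : vedge v t \in star v by rewrite starE imset_f.
  by have := h (exist (fun e => e \in star v) _ it); rewrite ffunE.
rewrite ffunE; case: e => e /= ie; move: (ie); rewrite {1}starE.
by move=> /imsetP[t _ ->].
Qed.

Lemma loopsP (L : config m n) :
  reflect (forall v, L (vedge v t0) + L (vedge v t1) + L (vedge v t2) = 0 /\
    ~~ [&& L (vedge v t0) == 0, L (vedge v t1) == 0 & L (vedge v t2) == 0])
    (L \in loops m n).
Proof.
rewrite inE; apply/(iffP forallP) => h v; have := h v; rewrite allowedE.
  by move=> /andP[/eqP].
by case=> -> ->; rewrite eqxx.
Qed.

(** The coboundary of the indicator function of [Q], oriented so that the three height differences
    cancel around every vertex of either kind. *)
Definition incidence (Q p : hexagon m n) (t : 'I_3) : 'Z_3 :=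
  [:: (p + a1 == Q)%:R - (p == Q)%:R; (p == Q)%:R - (p + a2 == Q)%:R;
      (p + a2 == Q)%:R - (p + a1 == Q)%:R]`_t.

Lemma incidence0 Q p : incidence Q p t0 = (p + a1 == Q)%:R - (p == Q)%:R.
Proof. by []. Qed.
Lemma incidence1 Q p : incidence Q p t1 = (p == Q)%:R - (p + a2 == Q)%:R.
Proof. by []. Qed.
Lemma incidence2 Q p : incidence Q p t2 = (p + a2 == Q)%:R - (p + a1 == Q)%:R.
Proof. by []. Qed.
Definition incidenceE := (incidence0, incidence1, incidence2).

(* The height of the hexagon [Q] is raised by [d]. *)
Definition recolor (L : config m n) (Q : hexagon m n) (d : 'Z_3) : config m n :=
  conf_of (fun p t => L (ed p t) + d * incidence Q p t).

Lemma recolorE L Q d p t :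
  recolor L Q d (ed p t) = L (ed p t) + d * incidence Q p t.
Proof. exact: conf_ofE. Qed.

Lemma incidence_off Q p t : ed p t \notin hex_edges Q -> incidence Q p t = 0.
Proof.
rewrite inE; case: (I3_cases t) => ->; rewrite val_ed !inE negb_or incidenceE;
  by rewrite ![Q == _]eq_sym => /andP[/negPf-> /negPf->]; rewrite subr0.
Qed.

Ltac site_lia := rewrite ?siteE ?site_small; lia.
Ltac site_dec := rewrite ?site_small; clear; lia.

(** At each of the six vertices of [Q] the outer leg is unchanged, so the changes of the two hexagon
    edges cancel. Hence the change alternates in sign around [Q], as [incidence Q] does. *)
Lemma move_recolor (L L' : config m n) Q :
  L \in loops m n -> L' \in loops m n ->
  (forall e, e \notin hex_edges Q -> L' e = L e) ->
  exists d, L' = recolor L Q d.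
Proof.
move=> /loopsP lL /loopsP lL' off.
pose g p t := L' (ed p t) - L (ed p t).
have goff p t : Q \notin val (ed p t) -> g p t = 0.
  by move=> h; rewrite /g off ?subrr // inE.
have gA p : g p t0 + g p t1 + g p t2 = 0.
  have [/= e _] := lL (inl p); have [/= e' _] := lL' (inl p).
  by rewrite /g -[RHS](subrr 0) -[X in _ = X - _]e' -[X in _ = _ - X]e; ring.
have gB p : g (p + a2) t0 + g (p + a1) t1 + g p t2 = 0.
  have [+ _] := lL (inr p); have [+ _] := lL' (inr p).
  rewrite /= !shiftBE addr0 => e' e.
  by rewrite /g -[RHS](subrr 0) -[X in _ = X - _]e' -[X in _ = _ - X]e; ring.
(* The edge [ed Q t1] has incidence 1, so its change is the height increment. *)
exists (g Q t1); apply: conf_ext => p t; rewrite recolorE.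
suff -> : g Q t1 * incidence Q p t = g p t by rewrite /g addrC subrK.
have [x [y QE]] := siteP Q.
have off0 i j : (i, j) != (0, 0) -> (i, j) != (-1, 0) -> `|i| <= 5 -> `|j| <= 5 ->
    g (site (x + i) (y + j)) t0 = 0.
  rewrite !xpair_eqE => *; apply: goff; rewrite val_ed QE !inE; site_lia.
have off1 i j : (i, j) != (0, 0) -> (i, j) != (0, -1) -> `|i| <= 5 -> `|j| <= 5 ->
    g (site (x + i) (y + j)) t1 = 0.
  rewrite !xpair_eqE => *; apply: goff; rewrite val_ed QE !inE; site_lia.
have off2 i j : (i, j) != (-1, 0) -> (i, j) != (0, -1) -> `|i| <= 5 -> `|j| <= 5 ->
    g (site (x + i) (y + j)) t2 = 0.
  rewrite !xpair_eqE => *; apply: goff; rewrite val_ed QE !inE; site_lia.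
have gA' i j := gA (site (x + i) (y + j)).
have gB' i j : g (site (x + i) (y + (j + 1))) t0 + g (site (x + (i + 1)) (y + j)) t1
    + g (site (x + i) (y + j)) t2 = 0.
  by have := gB (site (x + i) (y + j)); rewrite !siteE !addrA.
(* Five vertex equations in cyclic order carry the change from [ed Q t1] to the other five edges. *)
have := gA' 0 (-1); have := gB' (-1) (-1); have := gA' (-1) 0.
have := gB' (-1) 0; have := gA' 0 0; rewrite !addNr add0r.
rewrite (off2 0 0) // (off0 (-1) 1) // (off1 (-1) 0) // (off2 (-1) (-1)) //.
rewrite (off0 0 (-1)) // !addr0 !add0r -QE.
move=> /(canRL (addrK _)) e0 /(canRL (addKr _)) e2.
rewrite e2 addr0 => /(canRL (addrK _)) e0'; rewrite e0' sub0r opprK.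
move=> /(canRL (addKr _)) e1; rewrite e1 addr0 => /(canRL (addKr _)) e2'.
have down1 u : u + a1 = Q -> u = site (x - 1) y.
  by move=> /(canRL (addrK _)) ->; rewrite QE !siteE.
have down2 u : u + a2 = Q -> u = site x (y - 1).
  by move=> /(canRL (addrK _)) ->; rewrite QE !siteE.
case: (I3_cases t) => ->; rewrite incidenceE.
- case: (eqVneq p Q) => [->|pQ].
    by rewrite [_ == _](_ : _ = false) ?e0; [rewrite /=; ring|rewrite QE; site_lia].
  case: (eqVneq (p + a1) Q) => [/down1->|qQ]; first by rewrite e0' /=; ring.
  rewrite (_ : g p t0 = 0) ?subrr ?mulr0 //; apply: goff.
  by rewrite val_ed !inE !(eq_sym Q) negb_or pQ qQ.
- case: (eqVneq p Q) => [->|pQ].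
    by rewrite [Q + a2 == Q](_ : _ = false); [rewrite /=; ring|rewrite QE; site_lia].
  case: (eqVneq (p + a2) Q) => [/down2->|qQ]; first by rewrite e1 /=; ring.
  rewrite (_ : g p t1 = 0) ?subrr ?mulr0 //; apply: goff.
  by rewrite val_ed !inE !(eq_sym Q) negb_or pQ qQ.
- case: (eqVneq (p + a2) Q) => [/down2->|pQ].
    by rewrite [_ + _ == _](_ : _ = false) ?e2'; [rewrite /=; ring|rewrite QE;
      site_lia].
  case: (eqVneq (p + a1) Q) => [/down1->|qQ]; first by rewrite e2 /=; ring.
  rewrite (_ : g p t2 = 0) ?subrr ?mulr0 //; apply: goff.
  by rewrite val_ed !inE !(eq_sym Q) negb_or qQ pQ.
Qed.

Lemma recolor_off L Q d e : e \notin hex_edges Q -> recolor L Q d e = L e.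
Proof.
have [p [t ->]] := ed_surj e; move=> /incidence_off.
by rewrite recolorE => ->; rewrite mulr0 addr0.
Qed.

Lemma moveP (L L' : config m n) :
  reflect [/\ L \in loops m n, L' \in loops m n & exists Q d, L' = recolor L Q d]
    (one_hexagon_move L L').
Proof.
apply: (iffP and3P) => [[lL lL' /existsP[Q /forallP off]]|[lL lL' [Q [d L'E]]]].
  split=> //; exists Q; apply: move_recolor => // e eQ.
  by apply/eqP/(implyP (off e)).
split=> //; apply/existsP; exists Q; apply/forallP => e; apply/implyP => eQ.
by rewrite L'E recolor_off.
Qed.

Lemma recolorK L Q d : recolor (recolor L Q d) Q (- d) = L.
Proof. by apply: conf_ext => p t; rewrite !recolorE mulNr addrK. Qed.

Lemma move_sym : symmetric (@one_hexagon_move m n).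
Proof.
suff h (L L' : config m n) : one_hexagon_move L L' -> one_hexagon_move L' L.
  by move=> L L'; apply/idP/idP; apply: h.
move=> /moveP[lL lL' [Q [d L'E]]]; apply/moveP; split=> //.
by exists Q, (- d); rewrite L'E recolorK.
Qed.

Lemma connect_move_sym : connect_sym (@one_hexagon_move m n).
Proof. exact/sym_connect_sym/move_sym. Qed.

(** * Heights on the universal cover *)

Lemma int_step (P : int -> Prop) : P 0 -> (forall k, P k -> P (k + 1)) ->
  (forall k, P k -> P (k - 1)) -> forall k, P k.
Proof.
move=> P0 up down; elim/int_rect => [//|k /up|k /down].
  by rewrite -addn1 PoszD.
by rewrite -addn1 PoszD opprD.
Qed.

(** The discrete antiderivative of [u] on the integers that vanishes at 0. *)
Definition primitive (u : int -> 'Z_3) (x : int) : 'Z_3 :=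
  match x with
  | Posz k => \sum_(i < k) u i%:Z
  | Negz k => - \sum_(i < k.+1) u (- i.+1%:Z)
  end.

Lemma primitiveS u x : primitive u (x + 1) = primitive u x + u x.
Proof.
case: x => [k|[|k]].
- by rewrite -PoszD addn1 /= big_ord_recr.
- by rewrite /= big_ord_recl !big_ord0 addr0 addNr.
have -> : Negz k.+1 + 1 = Negz k by lia.
by rewrite /= [in RHS]big_ord_recr /= opprD -addrA [X in _ + X]addNr addr0.
Qed.

(** Heights live on the cover because fluxes make them multivalued on the torus; the signs are those
    of [incidence]. *)
Definition lifts (L : config m n) (h : int -> int -> 'Z_3) : Prop :=
  forall x y, [/\ L (ed (site x y) t0) = h (x + 1) y - h x y,
                  L (ed (site x y) t1) = h x y - h x (y + 1)
                & L (ed (site x y) t2) = h x (y + 1) - h (x + 1) y].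

Lemma eliminate (a b c v w : 'Z_3) :
  a + v + c = 0 -> b + w + c = 0 -> b = a + v - w.
Proof.
move=> A B; have -> : b = (b + w + c) - (a + v + c) + (a + v - w) by ring.
by rewrite A B; ring.
Qed.

Lemma subr_swap (a b c d : 'Z_3) : a - b = c - d -> c - a = d - b.
Proof.
move=> E; have -> : c = c - d - (a - b) + (d + a - b) by ring.
by rewrite E; ring.
Qed.

(** Integrate the type 0 edges along row 0, then the type 1 edges vertically. The other horizontal
    differences follow row by row from the two vertex equations that share a type 2 edge. *)
Lemma lifts_exist (L : config m n) : L \in loops m n -> exists h, lifts L h.
Proof.
move=> /loopsP lL.
have gA p : L (ed p t0) + L (ed p t1) + L (ed p t2) = 0.
  by have [] := lL (inl p).
have gB p : L (ed (p + a2) t0) + L (ed (p + a1) t1) + L (ed p t2) = 0.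
  by have [+ _] := lL (inr p); rewrite /= !shiftBE addr0.
pose h x y := primitive (fun i => L (ed (site i 0) t0)) x
              - primitive (fun j => L (ed (site x j) t1)) y.
have hV x y : L (ed (site x y) t1) = h x y - h x (y + 1).
  by rewrite /h primitiveS /=; ring.
have hH x y : L (ed (site x y) t0) = h (x + 1) y - h x y.
  elim/int_step: y => [|y IH|y IH].
  - by rewrite /h primitiveS /= !big_ord0; ring.
  - have := gB (site x y); rewrite !siteE => /(eliminate (gA (site x y))) ->.
    by rewrite IH !hV; ring.
  - have := gB (site x (y - 1)); rewrite !siteE subrK => B.
    rewrite (eliminate B (gA (site x (y - 1)))).
    by rewrite IH !hV !subrK; ring.
exists h => x y; split=> //.
have := gA (site x y); rewrite hH hV addrC => /(canRL (addrK _)) ->; ring.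
Qed.

(** Copies of a site see the same edge values, so [h] is periodic up to an additive constant. *)
Lemma lifts_trans L h u v x y : lifts L h -> site u v = site x y ->
  forall a b, h (u + a) (v + b) - h u v = h (x + a) (y + b) - h x y.
Proof.
move=> Lh E.
have Eab a b : site (u + a) (v + b) = site (x + a) (y + b) by rewrite -!siteD E.
suff key a b : h (u + a) (v + b) - h (x + a) (y + b) = h u v - h x y.
  by move=> a b; have /(canRL (subrK _)) -> := key a b; ring.
pose D a b := h (u + a) (v + b) - h (x + a) (y + b).
have H k l : D (k + 1) l = D k l.
  have [+ _ _] := Lh (u + k) (v + l); have [+ _ _] := Lh (x + k) (y + l).
  by rewrite Eab => -> E'; rewrite /D !addrA; apply: subr_swap.
have V k l : D k (l + 1) = D k l.
  have [_ + _] := Lh (u + k) (v + l); have [_ + _] := Lh (x + k) (y + l).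
  by rewrite Eab => -> E'; rewrite /D !addrA; apply/esym/subr_swap.
suff : D a b = D 0 0 by rewrite /D !addr0.
elim/int_step: b => [|b <-|b <-]; last by rewrite -[LHS]V subrK.
- elim/int_step: a => [|a <-|a <-]; [by []|by rewrite H|];
  last by rewrite -[LHS]H subrK.
- by rewrite V.
Qed.

Definition valid (h : int -> int -> 'Z_3) : Prop := forall x y,
  ~~ ((h (x + 1) y == h x y) && (h x (y + 1) == h x y)) /\
  ~~ ((h (x + 1) y == h x y) && (h (x + 1) (y - 1) == h x y)).

Lemma lifts_valid L h : lifts L h -> L \in loops m n -> valid h.
Proof.
move=> Lh /loopsP lL x y; split; apply/negP => /andP[/eqP e1 /eqP e2].
  have [_ /=] := lL (inl (site x y)).
  by have [-> -> ->] := Lh x y; rewrite e1 e2 subrr.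
have [_ /=] := lL (inr (site x (y - 1))); rewrite !shiftBE !siteE subrK.
have [-> _ _] := Lh x y; have [_ -> _] := Lh (x + 1) (y - 1).
by have [_ _ ->] := Lh x (y - 1); rewrite !subrK e1 e2 subrr.
Qed.

Lemma recolor_lifts L h x y d : lifts L h ->
  lifts (recolor L (site x y) d)
    (fun u v => h u v + d * (site u v == site x y)%:R).
Proof.
move=> Lh u v; have [e0 e1 e2] := Lh u v.
by rewrite !recolorE e0 e1 e2 !incidenceE !siteE; split; ring.
Qed.

Definition neighbors_ok (h : int -> int -> 'Z_3) x y c : bool :=
  recolorable c (h (x - 1) y) (h (x - 1) (y + 1)) (h x (y + 1)) (h (x + 1) y)
    (h (x + 1) (y - 1)) (h x (y - 1)).

Lemma valid_loops L h : lifts L h -> valid h -> L \in loops m n.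
Proof.
move=> Lh vh; apply/loopsP => -[p|p] /=.
  have [x [y ->]] := siteP p; have [-> -> ->] := Lh x y.
  split; first by ring.
  have [/negP nA _] := vh x y; apply/negP => /and3P[/eqP e1 /eqP e2 _].
  by apply: nA; rewrite (subr0_eq e1) -(subr0_eq e2) eqxx.
have [x [y ->]] := siteP p; rewrite !shiftBE !siteE.
have [-> _ _] := Lh x (y + 1); have [_ -> _] := Lh (x + 1) y.
have [_ _ ->] := Lh x y; split; first by ring.
have [_ /negP nB] := vh x (y + 1); apply/negP => /and3P[e1 e2 _]; apply: nB.
by rewrite !subr_eq0 in e1 e2; rewrite addrK (eqP e2) e1.
Qed.

Lemma lifts_eq L h u v x y a b : lifts L h -> site u v = site x y ->
  (h (u + a) (v + b) == h u v) = (h (x + a) (y + b) == h x y).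
Proof.
by move=> Lh E; rewrite -subr_eq0 (lifts_trans Lh E) subr_eq0.
Qed.

Lemma lifts_mono L h u v x y : lifts L h -> site u v = site x y ->
  (h (u + 1) v == h u v = (h (x + 1) y == h x y)) *
  ((h u (v + 1) == h u v) = (h x (y + 1) == h x y)) *
  ((h (u + 1) (v - 1) == h u v) = (h (x + 1) (y - 1) == h x y)).
Proof.
move=> Lh E; have := lifts_eq 1 0 Lh E; have := lifts_eq 0 1 Lh E.
by have := lifts_eq 1 (-1) Lh E; rewrite !addr0 => -> -> ->.
Qed.

Lemma site_shift u v x y i j : site u v = site x y ->
  site (u + i) (v + j) = site (x + i) (y + j).
Proof. by rewrite -!siteD => ->. Qed.

(** Only triangles with a corner over the recolored hexagon can become monochromatic. [lifts_mono]
    carries them to the copy at [(x, y)], where three corners for each of two orientations give the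
    six conditions of [neighbors_ok]. *)
Lemma recolor_loops L h x y c : lifts L h -> L \in loops m n ->
  neighbors_ok h x y c -> recolor L (site x y) (c - h x y) \in loops m n.
Proof.
move=> Lh lL ok; have L'h' := recolor_lifts x y (c - h x y) Lh.
apply: (valid_loops L'h'); set h' := fun u v => _ in L'h' *.
have vh := lifts_valid Lh lL.
have h'Q : h' x y = c by rewrite /h' eqxx mulr1 addrC subrK.
have h'E u v : site u v != site x y -> h' u v = h u v.
  by move=> /negPf E; rewrite /h' E mulr0 addr0.
have nbr i j : `|i| <= 5 -> `|j| <= 5 -> (i, j) != (0, 0) -> h' (x + i) (y + j) = h (x
  + i) (y + j).
  by rewrite xpair_eqE => *; apply: h'E; rewrite site_small; lia.
have nbr1 i : `|i| <= 5 -> i != 0 -> h' (x + i) y = h (x + i) y.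
  by move=> i5 i0; have := nbr i 0; rewrite addr0; apply;
    rewrite // xpair_eqE (negPf i0).
have nbr2 j : `|j| <= 5 -> j != 0 -> h' x (y + j) = h x (y + j).
  by move=> j5 j0; have := nbr 0 j; rewrite addr0; apply;
    rewrite // xpair_eqE (negPf j0) andbF.
move: ok => /and5P[n1 n2 n3 n4 /andP[n5 n6]].
move=> u v; split.
- case: (eqVneq (site u v) (site x y)) => [E|N0].
    rewrite !(lifts_mono L'h' E) h'Q nbr1 // nbr2 //.
    by rewrite andbC.
  case: (eqVneq (site (u + 1) v) (site x y)) => [E|N1].
    have {}E : site u v = site (x - 1) y.
      by have := site_shift (-1) 0 E; rewrite addrK !addr0.
    rewrite !(lifts_mono L'h' E) subrK h'Q nbr // nbr1 //.
    by apply: contraNN n1 => /andP[/eqP-> /eqP->]; rewrite eqxx.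
  case: (eqVneq (site u (v + 1)) (site x y)) => [E|N2].
    have {}E : site u v = site x (y - 1).
      by have := site_shift 0 (-1) E; rewrite addrK !addr0.
    rewrite !(lifts_mono L'h' E) subrK h'Q nbr // nbr2 //.
    by apply: contraNN n5 => /andP[/eqP-> /eqP->]; rewrite eqxx.
  by rewrite !h'E //; have [] := vh u v.
- case: (eqVneq (site u v) (site x y)) => [E|N0].
    by rewrite !(lifts_mono L'h' E) h'Q nbr1 // nbr //.
  case: (eqVneq (site (u + 1) v) (site x y)) => [E|N1].
    have {}E : site u v = site (x - 1) y.
      by have := site_shift (-1) 0 E; rewrite addrK !addr0.
    rewrite !(lifts_mono L'h' E) subrK h'Q nbr2 // nbr1 //.
    by apply: contraNN n6 => /andP[/eqP-> /eqP->]; rewrite eqxx.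
  case: (eqVneq (site (u + 1) (v - 1)) (site x y)) => [E|N2].
    have {}E : site u v = site (x - 1) (y + 1).
      by have := site_shift (-1) 1 E; rewrite addrK subrK.
    rewrite !(lifts_mono L'h' E) subrK addrK h'Q nbr // nbr2 //.
    by apply: contraNN n2 => /andP[/eqP-> /eqP->]; rewrite eqxx.
  by rewrite !h'E //; have [] := vh u v.
Qed.

(** A type 0 edge has value 0 exactly when its two hexagons have equal heights; this is the quantity
    to be minimized. *)
Definition zeros (L : config m n) : nat := (\sum_p (L (ed p t0) == 0%R))%N.

Lemma zeros_recolor L h x y c : lifts L h ->
  (zeros (recolor L (site x y) (c - h x y)%R)
     + ((h x y == h (x - 1)%R y) + (h x y == h (x + 1)%R y))
   = zeros L + ((c == h (x - 1)%R y) + (c == h (x + 1)%R y)))%N.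
Proof.
move=> Lh; have n12 : site x y != site (x - 1) y by site_lia.
rewrite /zeros (bigD1 (site x y)) //= (bigD1 (site (x - 1) y)) ?(eq_sym (site (x - 1)
  y)) //=.
rewrite [in RHS](bigD1 (site x y)) //= [in RHS](bigD1 (site (x - 1) y)) ?(eq_sym (site
  (x - 1) y)) //=.
set S1 := (\sum_(_ | _) _)%N; set S2 := (\sum_(_ | _) _)%N.
have <- : S1 = S2.
  apply: eq_bigr => p /andP[p1 p2]; rewrite recolorE incidence0.
  rewrite (negPf p1) [p + a1 == _](_ : _ = false) ?subrr ?mulr0 ?addr0 //.
  apply: contraNF p2 => /eqP E; rewrite -(addrK a1 p) E a1E siteB subr0; exact/eqP.
have L'h' := recolor_lifts x y (c - h x y) Lh.
have [-> _ _] := L'h' x y; have [-> _ _] := L'h' (x - 1) y.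
have [-> _ _] := Lh x y; have [-> _ _] := Lh (x - 1) y.
rewrite !subrK eqxx [site (x + 1) y == _](_ : _ = false); last by site_lia.
rewrite [site (x - 1) y == _](_ : _ = false); last by site_lia.
rewrite /= mulr1 mulr0 !addr0 (addrC (h x y)) subrK !subr_eq0.
rewrite (eq_sym c (h (x + 1) y)) (eq_sym (h x y) (h (x + 1) y)).
clear; do 4!case: (_ == _); rewrite /=; lia.
Qed.

(** * Crystalline configurations and their isolation *)

Lemma crystalsP (C : config m n) :
  reflect (exists2 s : 'I_3 -> 'Z_3, injective s & forall p t, C (ed p t) = s t)
    (C \in crystals m n).
Proof.
rewrite inE; apply: (iffP existsP) => [[s /andP[/injectiveP inj /forallP Cs]]|[s inj
  Cs]].
  exists s => // p t; apply/eqP; have /forallP/(_ (ed p t))/implyP := Cs t.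
  by apply; rewrite inE; apply/existsP; exists p.
exists (finfun s); apply/andP; split.
  by apply/injectiveP => t t'; rewrite !ffunE => /inj.
apply/forallP => t; apply/forallP => e; apply/implyP;
  rewrite inE => /existsP[p /eqP eE].
by rewrite ffunE -(Cs p); apply/eqP; congr (C _); apply/val_inj.
Qed.

Lemma lifts_crystal L h (s t : 'Z_3) : lifts L h ->
  (forall x y, h (x + 1) y = h x y + s) -> (forall x y, h x (y + 1) = h x y + t) ->
  s != - t -> s != t - s -> - t != t - s -> L \in crystals m n.
Proof.
move=> Lh hs ht d1 d2 d3; apply/crystalsP.
exists (fun i : 'I_3 => [:: s; - t; t - s]`_i).
  move=> i j; case: (I3_cases i) => ->; case: (I3_cases j) => -> //=;
  by move=> /eqP; rewrite ?(negPf d1) ?(negPf d2) ?(negPf d3) // eq_sym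
    ?(negPf d1) ?(negPf d2) ?(negPf d3).
move=> p i; have [x [y ->]] := siteP p; have [e0 e1 e2] := Lh x y.
by case: (I3_cases i) => ->; rewrite (e0, e1, e2) /= ?hs ?ht; ring.
Qed.

(** In a stripe pattern a hexagon has two adjacent neighbors of each of the two other colors, so any
    recoloring creates a monochromatic triangle. The conditions at its six vertices are checked by
    enumeration. *)
Lemma crystal_isolated (C L : config m n) :
  C \in crystals m n -> one_hexagon_move C L -> L = C.
Proof.
move=> /crystalsP[s inj Cs] /moveP[_ /loopsP lL [Q [d LE]]].
have [x [y QE]] := siteP Q.
have nz p t : L (ed p t) = s t + d * incidence Q p t by rewrite LE recolorE Cs.
suff d0 : d = 0 by rewrite LE d0; apply: conf_ext => p t; rewrite recolorE mul0r addr0.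
have nA i j := (lL (inl (site (x + i) (y + j)))).2.
have nB i j := (lL (inr (site (x + i) (y + j)))).2.
have := nA 0 0; have := nA (-1) 0; have := nA 0 (-1).
have := nB (-1) 0; have := nB 0 (-1); have := nB (-1) (-1).
rewrite /= !nz !shiftBE !incidenceE QE !siteE.
have d01 : s t0 != s t1 by apply/eqP => /inj.
have d02 : s t0 != s t2 by apply/eqP => /inj.
have d12 : s t1 != s t2 by apply/eqP => /inj.
rewrite !site_small; [|lia..]; rewrite !subrK !eqxx.
have xp : (x + 1 == x) = false by lia.
have xm : (x - 1 == x) = false by lia.
have yp : (y + 1 == y) = false by lia.
have ym : (y - 1 == y) = false by lia.
rewrite !(xp, xm, yp, ym) /=; clear -d01 d02 d12; move: d01 d02 d12.
by case: (Z3_cases (s t0)) => ->; case: (Z3_cases (s t1)) => ->;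
  case: (Z3_cases (s t2)) => ->; case: (Z3_cases d) => ->.
Qed.

Lemma crystal_component (C L : config m n) :
  C \in crystals m n -> connect (@one_hexagon_move m n) C L -> L = C.
Proof.
move=> cC /connectP[s + ->]; elim: s => //= L1 s IH /andP[/(crystal_isolated cC) ->].
exact: IH.
Qed.

(** * Removing equal horizontal neighbors *)

Section Component.
Variable L0 : config m n.
Hypothesis loops_L0 : L0 \in loops m n.

Lemma connect_loops L : connect (@one_hexagon_move m n) L0 L -> L \in loops m n.
Proof.
move=> /connectP[s + ->]; elim: s L0 loops_L0 => //= L1 s IH L2 _.
by move=> /andP[/and3P[_ lL1 _]]; exact: IH.
Qed.

Definition reach (h : int -> int -> 'Z_3) (k : nat) : Prop :=
  exists L, [/\ connect (@one_hexagon_move m n) L0 L, lifts L h & zeros L = k].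

(** All copies of [(x, y)] receive the same increment rather than the same color, since their
    heights may differ by a flux. *)
Definition update (h : int -> int -> 'Z_3) x y c : int -> int -> 'Z_3 :=
  fun u v => h u v + (c - h x y) * (site u v == site x y)%:R.

Lemma update_site h x y c : update h x y c x y = c.
Proof. by rewrite /update eqxx mulr1 addrC subrK. Qed.

Lemma update_off h x y c u v : site u v != site x y -> update h x y c u v = h u v.
Proof. by rewrite /update => /negPf->; rewrite mulr0 addr0. Qed.

Lemma reach_update h k x y c : reach h k -> neighbors_ok h x y c ->
  exists2 k', reach (update h x y c) k' &
    (k' + ((h x y == h (x - 1)%R y) + (h x y == h (x + 1)%R y))
      = k + ((c == h (x - 1)%R y) + (c == h (x + 1)%R y)))%N.
Proof.
move=> [L [cL Lh zL]] ok; have lL := connect_loops cL.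
exists (zeros (recolor L (site x y) (c - h x y)));
  last by rewrite (zeros_recolor _ _ _ Lh) zL.
exists (recolor L (site x y) (c - h x y)); split=> //; last exact: recolor_lifts.
apply: connect_trans cL (connect1 _); apply/moveP; split=> //.
  exact: recolor_loops.
by exists (site x y), (c - h x y).
Qed.

Lemma reach_valid h k : reach h k -> valid h.
Proof. by move=> [L [/connect_loops lL Lh _]]; exact: lifts_valid Lh lL. Qed.

Section Minimum.
Variable k0 : nat.
Hypothesis k0_min : forall h k, reach h k -> (k0 <= k)%N.

(* For [up = true] the second frame axis points to the upper left neighbor, for
   [up = false] to the lower left one. *)
Definition frame_x (up : bool) (x i j : int) : int := if up then x + i - j else x + i.
Definition frame_y (up : bool) (y j : int) : int := if up then y + j else y - j.

Definition framed up x y (k : int) (H : nat -> nat -> 'Z_3) : Prop :=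
  exists h k', [/\ reach h k', k'%:Z = k0%:Z + k &
    forall i j : nat, H i j = h (frame_x up x i j) (frame_y up y j)].

Lemma framed_ge0 up x y k H : framed up x y k H -> 0 <= k.
Proof. by move=> [h [k' [/k0_min + + _]]]; lia. Qed.

Lemma framed_triangle up x y k H i j : framed up x y k H ->
  ~~ ((H i.+1 j == H i j) && (H i.+1 j.+1 == H i j)).
Proof.
move=> [h [k' [/reach_valid vh _ HE]]]; rewrite !HE /frame_x /frame_y.
case: up {HE}.
  have [+ _] := vh (x + i%:Z - j%:Z) (y + j%:Z).
  have -> : x + i.+1%:Z - j%:Z = x + i%:Z - j%:Z + 1 by lia.
  have -> : x + i.+1%:Z - j.+1%:Z = x + i%:Z - j%:Z by lia.
  by have -> : y + j.+1%:Z = y + j%:Z + 1 by lia.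
have [_] := vh (x + i%:Z) (y - j%:Z).
have -> : x + i.+1%:Z = x + i%:Z + 1 by lia.
by have -> : y - j.+1%:Z = y - j%:Z - 1 by lia.
Qed.

Lemma framed_recolor up x y k H i j c : framed up x y k H ->
  (i.+1 < 8)%N -> (j.+1 < 8)%N ->
  recolorable c (H i j.+1) (H i.+1 j.+2) (H i.+2 j.+2) (H i.+2 j.+1)
    (H i.+1 j) (H i j) ->
  exists H', [/\ framed up x y (k + ((c == H i j.+1) + (c == H i.+2 j.+1))%N%:Z
                      - ((H i.+1 j.+1 == H i j.+1)
                         + (H i.+1 j.+1 == H i.+2 j.+1))%N%:Z) H',
    H' i.+1 j.+1 = c &
    forall i' j', (i' < 8)%N -> (j' < 8)%N -> (i' != i.+1) || (j' != j.+1) ->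
      H' i' j' = H i' j'].
Proof.
move=> [h [k' [rh k'E HE]]] i8 j8 ok.
set X := frame_x up x i.+1 j.+1; set Y := frame_y up y j.+1.
have W : H i j.+1 = h (X - 1) Y.
  by rewrite HE; congr h; rewrite /X /frame_x; case: up {HE ok X Y}; lia.
have E : H i.+2 j.+1 = h (X + 1) Y.
  by rewrite HE; congr h; rewrite /X /frame_x; case: up {HE ok X Y W}; lia.
have [|k'' rh' k''E] := @reach_update h k' X Y c rh.
  move: ok; rewrite W E !HE /neighbors_ok /recolorable /X /Y /frame_x /frame_y.
  case: up {HE X Y W E}.
    have -> : x + i.+1%:Z - j.+2%:Z = x + i.+1%:Z - j.+1%:Z - 1 by lia.
    have -> : x + i.+2%:Z - j.+2%:Z = x + i.+1%:Z - j.+1%:Z by lia.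
    have -> : x + i.+1%:Z - j%:Z = x + i.+1%:Z - j.+1%:Z + 1 by lia.
    have -> : x + i%:Z - j%:Z = x + i.+1%:Z - j.+1%:Z by lia.
    have -> : y + j.+2%:Z = y + j.+1%:Z + 1 by lia.
    by have -> : y + j%:Z = y + j.+1%:Z - 1 by lia.
  have -> : x + i.+2%:Z = x + i.+1%:Z + 1 by lia.
  have -> : x + i%:Z = x + i.+1%:Z - 1 by lia.
  have -> : y - j.+2%:Z = y - j.+1%:Z - 1 by lia.
  have -> : y - j%:Z = y - j.+1%:Z + 1 by lia.
  move=> /and5P[o1 o2 o3 o4 /andP[o5 o6]].
  by apply/and5P; split; [| | | |apply/andP; split]; rewrite andbC.
exists (fun i j => update h X Y c (frame_x up x i j) (frame_y up y j)); split.
- exists (update h X Y c), k''; split=> //.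
  move: k''E; rewrite W E HE -/X -/Y.
  do 4!case: (_ == _); rewrite /=; move: k'E; clear; lia.
- exact: update_site.
(* Distinct positions of the 8 by 8 window are never copies of each other. *)
move=> i' j' i'8 j'8 ij; rewrite HE update_off // /X /Y /frame_x /frame_y.
by case: up {HE ok X Y W E rh' k''E}; rewrite site_small; move: i8 j8 i'8 j'8 ij;
  clear; lia.
Qed.

Lemma min_site_blocked h x y d : reach h k0 ->
  (h x y == h (x - 1) y) || (h x y == h (x + 1) y) ->
  d != h (x - 1) y -> d != h (x + 1) y ->
  (h (x - 1) (y + 1) = d /\ h x (y + 1) = d) \/
  (h x (y - 1) = d /\ h (x + 1) (y - 1) = d).
Proof.
move=> rh; pose H (i j : nat) := h (frame_x true x i j) (frame_y true (y - 1) j).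
have MH : framed true x (y - 1) 0 H by exists h, k0; split=> //; rewrite addr0.
have := @min_blocked _ 8 (@framed_ge0 _ _ _) (@framed_recolor _ _ _) _ 0 0 d MH isT isT.
rewrite /H /frame_x /frame_y subrK.
have -> : x + 1%:Z - 1%:Z = x by lia.
have -> : x + 0%:Z - 1%:Z = x - 1 by lia.
have -> : x + 2%:Z - 1%:Z = x + 1 by lia.
have -> : x + 1%:Z - 2%:Z = x - 1 by lia.
have -> : x + 2%:Z - 2%:Z = x by lia.
have -> : x + 0%:Z - 0%:Z = x by lia.
have -> : x + 1%:Z - 0%:Z = x + 1 by lia.
have -> : y - 1 + 2%:Z = y + 1 by lia.
by rewrite addr0.
Qed.

(** Otherwise a run starts at [x] and the third color is blocked there from above or from below; the
    frame pointing to that side shows the excluded [left_end]. *)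
Lemma min_no_left_end h x y : reach h k0 -> h x y = h (x + 1) y ->
  h (x - 1) y = h x y.
Proof.
move=> rh e; apply/eqP/contraT => nW.
have [d dW dE] := Z3_avoid2 (h (x - 1) y) (h (x + 1) y).
have dc : d != h x y by rewrite e.
have [|[u1 u2]|[u1 u2]] := min_site_blocked rh _ dW dE.
- by rewrite e eqxx orbT.
(* The origin of the frame puts the left end at [(2, 1)]. *)
- pose H (i j : nat) := h (frame_x true (x - 1) i j) (frame_y true (y - 1) j).
  have MH : framed true (x - 1) (y - 1) 0 H by exists h, k0; split=> //; rewrite addr0.
  have /negP[] := no_left_end (@framed_ge0 _ _ _) (@framed_triangle _ _ _)
    (@framed_recolor _ _ _) isT MH.
  rewrite /left_end /H /frame_x /frame_y.
  have -> : y - 1 + 1%:Z = y by lia.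
  have -> : x - 1 + 1%:Z - 1%:Z = x - 1 by lia.
  have -> : x - 1 + 2%:Z - 1%:Z = x by lia.
  have -> : x - 1 + 3%:Z - 1%:Z = x + 1 by lia.
  have -> : x - 1 + 2%:Z - 2%:Z = x - 1 by lia.
  have -> : x - 1 + 3%:Z - 2%:Z = x by lia.
  have -> : y - 1 + 2%:Z = y + 1 by lia.
  by rewrite nW -e u1 u2 !eqxx dW dc.
- pose H (i j : nat) := h (frame_x false (x - 2) i j) (frame_y false (y + 1) j).
  have MH : framed false (x - 2) (y + 1) 0 H by exists h, k0; split=> //; rewrite addr0.
  have /negP[] := no_left_end (@framed_ge0 _ _ _) (@framed_triangle _ _ _)
    (@framed_recolor _ _ _) isT MH.
  rewrite /left_end /H /frame_x /frame_y.
  have -> : y + 1 - 1%:Z = y by lia.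
  have -> : x - 2 + 1%:Z = x - 1 by lia.
  have -> : x - 2 + 2%:Z = x by lia.
  have -> : x - 2 + 3%:Z = x + 1 by lia.
  have -> : y + 1 - 2%:Z = y - 1 by lia.
  by rewrite nW -e u1 u2 !eqxx dW dc.
Qed.

Lemma reach_periodic h k x y q r : reach h k ->
  forall a b, h (x + q * m%:Z + a) (y + r * n%:Z + b) - h (x + q * m%:Z) (y + r * n%:Z)
            = h (x + a) (y + b) - h x y.
Proof.
move=> [L [_ Lh _]]; apply: (lifts_trans Lh); apply/eqP; rewrite site_eq.
by rewrite (addrC x) addrK (addrC y) addrK !dvdz_mull.
Qed.

Definition flat (h : int -> int -> 'Z_3) y := forall x, h (x + 1) y = h x y.

(** Equality extends to the left without end, and periodicity brings every column to the left of
    [x]. *)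
Lemma min_flat_row h x y : reach h k0 -> h x y = h (x + 1) y -> flat h y.
Proof.
move=> rh e.
have left (j : nat) : h (x - j%:Z + 1) y = h (x - j%:Z) y.
  elim: j => [|j IH]; first by rewrite subr0.
  have -> : x - j.+1%:Z = x - j%:Z - 1 by lia.
  by rewrite subrK (min_no_left_end rh).
move=> z; have := reach_periodic z y (- `|z - x|) 0 rh 1 0.
rewrite mul0r !addr0.
rewrite mulNr; set K := `|z - x| * m%:Z.
have xzK : `|z - x| <= K by rewrite ler_peMr //; lia.
have -> : z - K = x - `|(K - (z - x))%R|%N%:Z by clearbody K; lia.
by rewrite left subrr => /esym/eqP; rewrite subr_eq0 => /eqP.
Qed.

(** On a flat row both other colors are blocked at every site. One pair cannot block two colors, so
    one color fills the pair above and the other the pair below. *)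
Lemma min_flat_next h y : reach h k0 -> flat h y ->
  [/\ flat h (y + 1), flat h (y - 1) &
    forall x, h x (y + 1) != h x y /\ h x (y + 1) - h x y = h x y - h x (y - 1)].
Proof.
move=> rh fy.
have key x : [/\ h (x - 1) (y + 1) = h x (y + 1), h (x + 1) (y - 1) = h x (y - 1),
    h x (y + 1) != h x y & h x (y + 1) - h x y = h x y - h x (y - 1)].
  have W : h (x - 1) y = h x y by rewrite -(fy (x - 1)) subrK.
  have b d : d != h x y -> (h (x - 1) (y + 1) = d /\ h x (y + 1) = d) \/
      (h x (y - 1) = d /\ h (x + 1) (y - 1) = d).
    by move=> dh; apply: min_site_blocked rh _ _ _; rewrite ?W ?fy ?eqxx.
  have cp : h x y + 1 != h x y by case: (Z3_cases (h x y)) => ->.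
  have cm : h x y - 1 != h x y by case: (Z3_cases (h x y)) => ->.
  have pm : h x y + 1 <> h x y - 1 by case: (Z3_cases (h x y)) => ->.
  have [[u1 u2]|[u1 u2]] := b _ cp; have [[v1 v2]|[v1 v2]] := b _ cm.
  - by case: pm; rewrite -u1 -v1.
  - by rewrite u1 u2 v1 v2; split=> //; ring.
  - rewrite u1 u2 v1 v2; split=> //; ring.
  - by case: pm; rewrite -u1 -v1.
split=> [x|x|x]; first by have [+ _ _ _] := key (x + 1); rewrite addrK.
  by have [] := key x.
by have [] := key x.
Qed.

Lemma min_zero_crystal h x y : reach h k0 -> h x y = h (x + 1) y ->
  exists2 L, connect (@one_hexagon_move m n) L0 L & L \in crystals m n.
Proof.
move=> rh e; have [L [cL Lh _]] := rh; exists L => //.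
have fy := min_flat_row rh e.
have f z : flat h (y + z).
  elim/int_step: z => [|z IH|z IH]; first by rewrite addr0.
    by have [+ _ _] := min_flat_next rh IH; rewrite addrA.
  by have [_ + _] := min_flat_next rh IH; rewrite addrA.
have {}f z : flat h z by have := f (z - y); rewrite addrC subrK.
have t0N : h 0 (0 + 1) != h 0 0 by have [_ _ /(_ 0)[]] := min_flat_next rh (f 0).
pose t := h 0 (0 + 1) - h 0 0.
have tn0 : t != 0 by rewrite subr_eq0.
have dstep z : h 0 (z + 1) - h 0 z = t.
  elim/int_step: z => [//|z IH|z IH].
    by have [_ _ /(_ 0)[_ ->]] := min_flat_next rh (f (z + 1)); rewrite addrK.
  by rewrite subrK -IH; have [_ _ /(_ 0)[_ ->]] := min_flat_next rh (f z).
have step z : h 0 (z + 1) = h 0 z + t by rewrite -(dstep z) [RHS]addrC subrK.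
have const z x' : h x' z = h 0 z.
  elim/int_step: x' => [//|x' IH|x' IH]; first by rewrite f.
  by rewrite -IH -(f z (x' - 1)) subrK.
apply: (@lifts_crystal L h 0 t Lh); rewrite ?subr0.
- by move=> x' z; rewrite f addr0.
- by move=> x' z; rewrite !(const _ x') step.
- by rewrite eq_sym oppr_eq0.
- by rewrite eq_sym.
- by move: tn0; case: (Z3_cases t) => ->.
Qed.

End Minimum.

(** * Colorings with proper rows *)

Definition proper (h : int -> int -> 'Z_3) := forall x y, h x y != h (x + 1) y.

Definition reachable (h : int -> int -> 'Z_3) := exists k, reach h k.

Lemma reachable_update h x y c : reachable h -> neighbors_ok h x y c ->
  reachable (update h x y c).
Proof. by move=> [k rh] /(reach_update rh)[k' rh' _]; exists k'. Qed.

Lemma reachable_eq h u v x y a b : reachable h -> site u v = site x y ->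
  (h (u + a) (v + b) == h u v) = (h (x + a) (y + b) == h x y).
Proof. by move=> [k [L [_ Lh _]]]; exact: lifts_eq Lh. Qed.

Lemma reachable_eq1 h u v x y : reachable h -> site u v = site x y ->
  (h u v == h (u + 1) v) = (h x y == h (x + 1) y).
Proof.
by move=> rh E; have := reachable_eq 1 0 rh E; rewrite !addr0 eq_sym => ->;
  rewrite eq_sym.
Qed.

Definition pstate h := reachable h /\ proper h.

Lemma proper_update h x y c : reachable (update h x y c) -> proper h ->
  c != h (x - 1) y -> c != h (x + 1) y -> proper (update h x y c).
Proof.
move=> rh' ph cW cE u v.
case: (eqVneq (site u v) (site x y)) => [E|N0].
  by rewrite (reachable_eq1 rh' E) update_site update_off //; site_dec.
case: (eqVneq (site (u + 1) v) (site x y)) => [E|N1].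
  have {}E : site u v = site (x - 1) y by have := site_shift (-1) 0 E;
    rewrite addrK !addr0.
  rewrite (reachable_eq1 rh' E) subrK update_site update_off 1?eq_sym //.
  by site_dec.
by rewrite !update_off.
Qed.

(** The two upper neighbors differ from each other, as do the two lower ones, so neither pair can
    obstruct. *)
Lemma proper_neighbors_ok h x y c : proper h -> c != h (x - 1) y ->
  c != h (x + 1) y -> neighbors_ok h x y c.
Proof.
move=> ph cW cE; rewrite /neighbors_ok /recolorable.
rewrite (eq_sym (h (x - 1) y)) (eq_sym (h (x + 1) y)) (negPf cW) (negPf cE).
rewrite !andbF /=; apply/andP; split.
  apply/negP => /andP[/eqP e1 /eqP e2]; have := ph (x - 1) (y + 1).
  by rewrite subrK e1 e2 eqxx.
rewrite andbT; apply/negP => /andP[/eqP e1 /eqP e2]; have := ph x (y - 1).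
by rewrite e1 e2 eqxx.
Qed.

Lemma pstate_flip h x y c : pstate h -> c != h (x - 1) y -> c != h (x + 1) y ->
  pstate (update h x y c).
Proof.
move=> [rh ph] cW cE; have rh' := reachable_update rh (proper_neighbors_ok ph cW cE).
by split=> //; apply: proper_update.
Qed.

(* This lets one restore the row [y] after another row has been changed. *)
Definition back (y : int) (h' h : int -> int -> 'Z_3) :=
  forall g, pstate g -> (forall x, g x y = h' x y) ->
  exists g', [/\ pstate g', forall x, g' x y = h x y &
    forall u v, ~~ (n %| v - y)%Z -> g' u v = g u v].

Lemma site_row u v x y : ~~ (n %| v - y)%Z -> site u v != site x y.
Proof. by rewrite site_eq => /negPf->; rewrite andbF. Qed.

Lemma back_refl y h : back y h h.
Proof. by move=> g sg gh; exists g. Qed.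

Lemma back_trans y h1 h2 h3 : back y h1 h2 -> back y h2 h3 -> back y h1 h3.
Proof.
move=> b12 b23 g sg g1; have [g' [sg' g'2 g'g]] := b12 g sg g1.
have [g'' [sg'' g''3 g''g']] := b23 g' sg' g'2; exists g''; split=> // u v nv.
by rewrite g''g' ?g'g.
Qed.

(** With proper rows a flip is governed by its own row alone, so it can be undone after any change
    of the other rows. *)
Lemma back_flip h x y c : pstate h -> back y (update h x y c) h.
Proof.
move=> [_ ph] g sg gh'.
have gW : g (x - 1) y = h (x - 1) y by rewrite gh' update_off //; site_dec.
have gE : g (x + 1) y = h (x + 1) y by rewrite gh' update_off //; site_dec.
exists (update g x y (h x y)); split.
- apply: pstate_flip => //; rewrite ?gW ?gE //.
  by rewrite eq_sym; have := ph (x - 1) y; rewrite subrK.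
- by move=> u; rewrite /update !gh' update_site /update; ring.
- by move=> u v nv; rewrite update_off // site_row.
Qed.

Definition extremum (h : int -> int -> 'Z_3) x y := h (x - 1) y == h (x + 1) y.

(** If [x - 1] is not an extremum already, then [x - 2], [x - 1] and [x] carry three colors, and
    giving [x] the color of [x - 2] makes it one. *)
Lemma extremum_left h x y : pstate h -> extremum h x y ->
  exists h', [/\ pstate h', extremum h' (x - 1) y, back y h' h &
    forall u v, ~~ (n %| v - y)%Z -> h' u v = h u v].
Proof.
move=> sh /eqP ex; have [_ ph] := sh.
case: (boolP (extremum h (x - 1) y)) => [ex'|nex].
  by exists h; split=> //; exact: back_refl.
have c1 : h (x - 1 - 1) y != h (x - 1) y by have := ph (x - 1 - 1) y; rewrite subrK.
exists (update h x y (h (x - 1 - 1) y)); split.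
- by apply: pstate_flip; rewrite // -?ex.
- by rewrite /extremum subrK update_site update_off //; site_dec.
- exact: back_flip.
- by move=> u v nv; rewrite update_off // site_row.
Qed.

Lemma extremum_lefts h x y (k : nat) : pstate h -> extremum h x y ->
  exists h', [/\ pstate h', extremum h' (x - k%:Z) y, back y h' h &
    forall u v, ~~ (n %| v - y)%Z -> h' u v = h u v].
Proof.
move=> sh ex; elim: k => [|k [h1 [s1 e1 b1 o1]]].
  by exists h; rewrite subr0; split=> //; exact: back_refl.
have [h2 [s2 e2 b2 o2]] := extremum_left s1 e1; exists h2; split=> //.
- by have -> : x - k.+1%:Z = x - k%:Z - 1 by lia.
- exact: back_trans b2 b1.
- by move=> u v nv; rewrite o2 ?o1.
Qed.

Lemma extremum_periodic h x y u v : reachable h -> site u v = site x y ->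
  extremum h u v = extremum h x y.
Proof.
move=> rh E; have := reachable_eq 2 0 rh (site_shift (-1) 0 E); rewrite !addr0.
rewrite /extremum eq_sym [RHS]eq_sym.
have -> : u - 1 + 2 = u + 1 by lia.
by have -> : x - 1 + 2 = x + 1 by lia.
Qed.

Lemma extremum_anywhere h x y z e : pstate h -> extremum h x y ->
  exists h', [/\ pstate h', extremum h' z y, h' z y != e, back y h' h &
    forall u v, ~~ (n %| v - y)%Z -> h' u v = h u v].
Proof.
move=> sh ex.
have [k kE] : exists k : nat, site (x - k%:Z) y = site z y.
  (* Walking [x - z] steps plus enough full turns to the left reaches a copy of column [z]. *)
  exists `|((x - z) + `|x - z| * m)%R|%N.
  set K := `|x - z| * m%:Z.
  have xzK : `|x - z| <= K by rewrite ler_peMr //; lia.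
  have -> : x - `|(x - z + K)%R|%N%:Z = z - K by clearbody K; lia.
  apply/eqP; rewrite site_eq subrr dvdz0 andbT.
  by rewrite addrAC subrr add0r rpredN dvdz_mull.
have [h1 [s1 e1 b1 o1]] := extremum_lefts k sh ex.
have {}e1 : extremum h1 z y by rewrite -(extremum_periodic _ kE) //; case: s1.
case: (eqVneq (h1 z y) e) => [he|hne]; last by exists h1; split.
(* An extremum may take either color different from that of its neighbors, so [e] can be avoided. *)
have [c cW ce] := Z3_avoid2 (h1 (z - 1) y) e.
exists (update h1 z y c); split.
- by apply: pstate_flip; rewrite // -(eqP e1).
- by rewrite /extremum !update_off ?(eqP e1) //; site_dec.
- by rewrite update_site.
- by apply: back_trans b1; apply: back_flip.
- by move=> u v nv; rewrite update_off ?o1 // site_row.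
Qed.

(** The pattern abca becomes acba through an intermediate pair cc or bb. The triangles on that pair
    have apexes [h z (y + 1)] and [h (z + 1) (y - 1)], and by hypothesis b or c is absent from
    both. *)
Lemma pstate_swap h z y : pstate h -> h (z - 1) y = h (z + 2) y ->
  ~~ (((h z (y + 1) == h z y) || (h (z + 1) (y - 1) == h z y)) &&
      ((h z (y + 1) == h (z + 1) y) || (h (z + 1) (y - 1) == h (z + 1) y))) ->
  exists h', [/\ pstate h', h' z y = h (z + 1) y, h' (z + 1) y = h z y &
    forall u v, site u v != site z y -> site u v != site (z + 1) y -> h' u v = h u v].
Proof.
move=> [rh ph] ends apex.
set a := h (z - 1) y in ends; set b := h z y in apex *.
set c := h (z + 1) y in apex *; set u := h z (y + 1) in apex.
set d := h (z + 1) (y - 1) in apex.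
have ab : a != b by have := ph (z - 1) y; rewrite subrK.
have bc : b != c by apply: ph.
have ca : c != a by have := ph (z + 1) y; rewrite ends -addrA.
have su : h (z - 1) (y + 1) != u by have := ph (z - 1) (y + 1); rewrite subrK.
have us : u != h (z + 1) (y + 1) by apply: ph.
have sd : h z (y - 1) != d by apply: ph.
have ds : d != h (z + 2) (y - 1) by have := ph (z + 1) (y - 1); rewrite -addrA.
have zz : z + 1 - 1 = z by rewrite addrK.
have zz2 : z + 1 + 1 = z + 2 by rewrite -addrA.
suff [h' [rh' h'z h'z1 h'E]] : exists h', [/\ reachable h', h' z y = c,
    h' (z + 1) y = b & forall p q, site p q != site z y ->
      site p q != site (z + 1) y -> h' p q = h p q].
  exists h'; split=> //; split=> // p q.
  case: (eqVneq (site p q) (site z y)) => [E|N0].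
    by rewrite (reachable_eq1 rh' E) h'z h'z1 eq_sym.
  case: (eqVneq (site p q) (site (z + 1) y)) => [E|N1].
    rewrite (reachable_eq1 rh' E) h'z1 h'E ?zz2 -?ends 1?eq_sym //; site_dec.
  case: (eqVneq (site (p + 1) q) (site z y)) => [E|N2].
    have {}E : site p q = site (z - 1) y by have := site_shift (-1) 0 E;
      rewrite addrK !addr0.
    rewrite (reachable_eq1 rh' E) subrK h'z h'E 1?eq_sym //; site_dec.
  case: (eqVneq (site (p + 1) q) (site (z + 1) y)) => [E|N3]; last by rewrite !h'E.
  case/eqP: N0; have := site_shift (-1) 0 E; rewrite !addrK !addr0 //.
(* If [c] occurs at neither apex, the site [z] is recolored first, otherwise [z + 1]. *)
have [/andP[uc dc]|bad] := boolP ((u != c) && (d != c)).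
  have r1 : reachable (update h z y c).
    apply: reachable_update => //; rewrite /neighbors_ok /recolorable -/a -/c -/u -/d.
    rewrite [a == c]eq_sym !(negPf ca, negPf uc, negPf dc) /= !andbF.
    by [].
  have r2 : reachable (update (update h z y c) (z + 1) y b).
    apply: reachable_update => //;
      rewrite /neighbors_ok /recolorable zz zz2 update_site.
    rewrite !update_off; [|site_dec..].
    rewrite -ends -/u -/d [c == b]eq_sym (negPf bc) (negPf ab) /= !andbF /=.
    rewrite andbT; apply/andP; split; apply/negP => /andP[/eqP e1 /eqP e2].
      by move: us; rewrite e1 e2 eqxx.
    by move: ds; rewrite e1 e2 eqxx.
  exists (update (update h z y c) (z + 1) y b); split=> //.
  - by rewrite update_off ?update_site //; site_dec.
  - by rewrite update_site.
  - by move=> p q n1 n2; rewrite !update_off.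
have /andP[ub db] : (u != b) && (d != b).
  by move: apex bad; rewrite -!negb_or !negbK; case: (_ || _); case: (_ || _).
have r1 : reachable (update h (z + 1) y b).
  apply: reachable_update => //; rewrite /neighbors_ok /recolorable zz zz2 -/b -/u -/d.
  by rewrite -ends (negPf ab) (negPf ub) (negPf db) !andbF.
have r2 : reachable (update (update h (z + 1) y b) z y c).
  apply: reachable_update => //; rewrite /neighbors_ok /recolorable update_site.
  rewrite !update_off; [|site_dec..].
  rewrite -/u -/d -/a (negPf bc) [a == c]eq_sym (negPf ca) /= !andbF /=.
  rewrite andbT; apply/andP; split; apply/negP => /andP[/eqP e1 /eqP e2].
    by move: su; rewrite e1 e2 eqxx.
  by move: sd; rewrite e1 e2 eqxx.
exists (update (update h (z + 1) y b) z y c); split=> //.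
- by rewrite update_site.
- by rewrite update_off ?update_site //; site_dec.
- by move=> p q n1 n2; rewrite !update_off.
Qed.

Lemma eq_off_row (h h' : int -> int -> 'Z_3) y :
  (forall u v, ~~ (n %| v - y)%Z -> h' u v = h u v) ->
  forall u i, 0 < `|i| <= 20 -> h' u (y + i) = h u (y + i).
Proof.
move=> E u i /andP[i0 i20]; apply: E; rewrite addrC addKr.
by rewrite dvdz_small //; move: i0; clear; lia.
Qed.

(** The obstructed case is [c = h (z + 1) y]. If [z + 1] is an extremum, it can be recolored out of
    the way. Otherwise the pattern is abca: an extremum brought to column [z] of the row above
    provides an apex that permits the swap, and that row is restored afterwards. *)
Lemma set_site h z y c x : pstate h -> extremum h x (y + 1) -> c != h (z - 1) y ->
  exists h', [/\ pstate h', h' z y = c &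
    forall u v, site u v != site z y -> site u v != site (z + 1) y -> h' u v = h u v].
Proof.
move=> sh ex ca; have [rh ph] := sh.
case: (eqVneq c (h z y)) => [->|cb]; first by exists h.
case: (eqVneq c (h (z + 1) y)) => [cE|cE]; last first.
  exists (update h z y c); split; [exact: pstate_flip|exact: update_site|].
  by move=> u v n1 n2; rewrite update_off.
have ab : h (z - 1) y != h z y by have := ph (z - 1) y; rewrite subrK.
have zz : z + 1 - 1 = z by rewrite addrK.
have zz2 : z + 1 + 1 = z + 2 by rewrite -addrA.
case: (eqVneq (h (z + 2) y) (h z y)) => [e2|n2].
  have s1 : pstate (update h (z + 1) y (h (z - 1) y)).
    by apply: pstate_flip; rewrite ?zz ?zz2 // e2.
  exists (update (update h (z + 1) y (h (z - 1) y)) z y c); split.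
  - apply: pstate_flip; rewrite // ?update_site // update_off //; site_dec.
  - exact: update_site.
  - by move=> u v n1 n3; rewrite !update_off.
have ends : h (z - 1) y = h (z + 2) y.
  apply: (@Z3_third (h z y) c); rewrite // eq_sym //.
  by have := ph (z + 1) y; rewrite zz2 cE.
(* The upper apex must avoid [c] if the lower apex has the color [h z y], and must avoid [h z y]
   otherwise. *)
have [h1 [s1 _ h1e b1 o1]] := extremum_anywhere z
  (if h (z + 1) (y - 1) == h z y then c else h z y) sh ex.
have r0 u : h1 u y = h u y.
  by have := eq_off_row o1 u (i := -1) isT; rewrite addrK.
have rm u : h1 u (y - 1) = h u (y - 1).
  by have := eq_off_row o1 u (i := -2) isT; have -> : y + 1 - 2 = y - 1 by clear; lia.
have bc : h z y != c by rewrite eq_sym.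
have [||h2 [s2 h2z h2z1 o2]] := @pstate_swap h1 z y s1.
- by rewrite !r0.
- rewrite !r0 rm -cE; move: h1e;
  case: (eqVneq (h (z + 1) (y - 1)) (h z y)) => [->|nd] ne.
    by rewrite (negPf ne) (negPf bc) andbF.
  by rewrite (negPf ne).
have [x'|h3 [s3 h3r o3]] := b1 h2 s2.
  by rewrite o2 // site_row //; have -> : y + 1 - y = 1 by [clear; lia];
    rewrite dvdz_small.
have r3 u v : ~~ (n %| v - (y + 1))%Z -> site u v != site z y ->
    site u v != site (z + 1) y -> h3 u v = h u v.
  by move=> nv n1 n2'; rewrite o3 // o2 // o1.
have noty : ~~ (n %| y - (y + 1))%Z.
  by have -> : y - (y + 1) = -1 by [clear; lia]; rewrite dvdz_small.
exists h3; split=> // [|u v n1 n2'].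
  by rewrite o3 // h2z r0 -cE.
(* Row [y + 1] itself has been restored; its copies are compared with the unchanged rows just above
   them, as height differences are periodic. *)
have [nv|] := boolP (n %| v - (y + 1))%Z; last by move=> nv; apply: r3.
have E : site u v = site u (y + 1) by apply/eqP; rewrite site_eq subrr dvdz0.
have nrow w : (n %| w - (y + 1))%Z -> h3 u (w + 1) = h u (w + 1).
  move=> nw; have Ew : site u (w + 1) = site u (y + 1 + 1).
    by apply/eqP; rewrite site_eq subrr dvdz0 /= opprD addrACA subrr addr0.
  apply: r3; last 2 first.
  - by rewrite Ew site_row //; have -> : y + 1 + 1 - y = 2 by [clear; lia];
    rewrite dvdz_small.
  - by rewrite Ew site_row //; have -> : y + 1 + 1 - y = 2 by [clear; lia];
    rewrite dvdz_small.
  rewrite addrAC rpredDl //; first by rewrite dvdz_small.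
have [[k3 [L3 [_ L3h _]]] _] := s3; have [k4 [L4 [_ L4h _]]] := rh.
have := lifts_trans L3h E 0 1; have := lifts_trans L4h E 0 1; rewrite !addr0.
have nv1 : (n %| y + 1 - (y + 1))%Z by rewrite subrr dvdz0.
rewrite (nrow v nv) (nrow _ nv1) h3r => <-.
by move/addrI/oppr_inj.
Qed.

Definition horizontal_twist (al : 'Z_3) :=
  forall h, reachable h -> forall x y, h (x + m%:Z) y = h x y + al.

(** The row is written from left to right, since [set_site] disturbs only the written site and the
    next one. *)
Lemma set_row al h y x (g : nat -> 'Z_3) : horizontal_twist al ->
  pstate h -> extremum h x (y + 1) ->
  (forall j, (j.+1 < m)%N -> g j != g j.+1) -> g m.-1 != g 0%N + al ->
  exists h', [/\ pstate h', forall j : nat, (j < m)%N -> h' j%:Z y = g j &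
    forall u v, ~~ (n %| v - y)%Z -> h' u v = h u v].
Proof.
move=> tw sh ex gg gm.
have y1 : ~~ (n %| y + 1 - y)%Z.
  by rewrite (_ : y + 1 - y = 1) ?dvdz_small //; clear; lia.
pose off h' := forall u v, ~~ (n %| v - y)%Z -> h' u v = h u v.
have exoff h' : off h' -> extremum h' x (y + 1) by move=> o; rewrite /extremum !o.
have step h1 z c : pstate h1 -> off h1 -> c != h1 (z - 1) y ->
    exists h', [/\ pstate h', off h', h' z y = c &
      forall u, site u y != site z y -> site u y != site (z + 1) y -> h' u y = h1 u y].
  move=> s1 o1 cz; have [h' [s' h'z o']] := set_site s1 (exoff _ o1) cz.
  exists h'; split=> // [u v nv|u n1 n2]; last exact: o'.
  by rewrite o' ?o1 // site_row.
have o0 : off h by [].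
(* Prepare the site -1 so that its color does not forbid [g 0] at the site 0. *)
have [w w2 w0] := Z3_avoid2 (h (- 1 - 1) y) (g 0%N).
have [h1 [s1 o1 h1w _]] := step h (- 1) w sh o0 w2.
have [|h2 [s2 o2 h20 _]] := step h1 0 (g 0%N) s1 o1.
  by rewrite sub0r h1w eq_sym.
have sweep (j : nat) : (j.+1 < m)%N ->
    exists h', [/\ pstate h', off h' & forall i : nat, (i <= j)%N -> h' i%:Z y = g i].
  elim: j => [_|j IH jm].
    by exists h2; split=> // i; rewrite leqn0 => /eqP->.
  have [h' [s' o' h'g]] := IH (ltnW jm).
  have [|h'' [s'' o'' h''z h''E]] := step h' j.+1%:Z (g j.+1) s' o'.
    have -> : j.+1%:Z - 1 = j%:Z by clear; lia.
    by rewrite h'g // eq_sym gg // ltnW.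
  exists h''; split=> // i; rewrite leq_eqVlt => /orP[/eqP->//|ij].
  have nsite k : (i < k < m)%N -> site i%:Z y != site k%:Z y.
    move=> /andP[ik km]; rewrite site_eq subrr dvdz0 andbT; apply/negP => /dvdzP[q].
    clear -ik km; case: q => q; first by nia.
    by rewrite NegzE; nia.
  rewrite h''E ?h'g //; first by apply: nsite; rewrite ij ltnW.
  have -> : j.+1%:Z + 1 = j.+2%:Z by clear; lia.
  by apply: nsite; rewrite jm leqW.
have m20 : (m.-2.+2 = m)%N by move: m_gt; clear; lia.
have [|h3 [s3 o3 h3g]] := sweep m.-2; first by move: m_gt; clear; lia.
have h3m : h3 m.-2%:Z y = g m.-2 by apply: h3g.
have mm1 : m.-1%:Z - 1 = m.-2%:Z by move: m_gt; clear; lia.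
have mp1 : m.-1%:Z + 1 = 0 + m%:Z by move: m_gt; clear; lia.
(* The last site is flipped rather than set: its right neighbor is a copy of the site 0, which must
   not change. *)
exists (update h3 m.-1%:Z y (g m.-1)); split.
- apply: pstate_flip => //; first by rewrite mm1 h3m eq_sym -{2}m20 gg // m20.
  by rewrite mp1 tw ?(h3g 0%N) //; case: s3.
- move=> i im; case: (eqVneq i m.-1) => [->|im1]; first exact: update_site.
  have im2 : (i <= m.-2)%N by move: im im1; clear; lia.
  rewrite update_off ?h3g //.
  rewrite site_eq subrr dvdz0 andbT; apply/negP => /dvdzP[q].
  move: im2 m_gt; clear; case: q => q; first by nia.
  by rewrite NegzE; nia.
- by move=> u v nv; rewrite update_off ?o3 // site_row.
Qed.

(** * Producing a local extremum *)

Lemma Z3_progression (a b c : 'Z_3) : a != b -> b != c -> a != c -> c - b = b - a.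
Proof.
move=> ab bc ac; apply/eqP; move: ab bc ac.
by case: (Z3_cases a) => ->; case: (Z3_cases b) => ->; case: (Z3_cases c) => ->.
Qed.

(** A progression of length three with nonzero difference would exhaust ['Z_3], but only the values
    0 and [s] are available. *)
Lemma Z3_progression_avoids (p q r s s' : 'Z_3) :
  p = 0 \/ p = s -> q = 0 \/ q = s -> r = 0 \/ r = s ->
  q - p = s' - s -> r - q = s' - s -> s' = s.
Proof.
move=> hp hq hr /eqP e1 /eqP e2; apply/eqP; move: e1 e2.
case: hp => ->; case: hq => ->; case: hr => ->;
  by case: (Z3_cases s) => ->; case: (Z3_cases s') => ->.
Qed.

Hypothesis L0_not_crystal : L0 \notin crystals m n.

Lemma reachable_not_crystal h k L : reach h k ->
  connect (@one_hexagon_move m n) L0 L -> L \notin crystals m n.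
Proof.
move=> rh cL; apply: contra L0_not_crystal => lC.
by rewrite connect_move_sym in cL; rewrite (crystal_component lC cL).
Qed.

(** Without extrema every row is an arithmetic progression, so any four consecutive sites read abca.
    Either some swap is possible and creates an extremum, or the apexes force constant slopes and
    the configuration is crystalline. *)
Lemma extremum_exists h : pstate h -> exists h' x y, pstate h' /\ extremum h' x y.
Proof.
move=> sh; have [rh ph] := sh.
have [[x [y ex]]|noex] := boolp.EM (exists x y, extremum h x y).
  by exists h, x, y.
have nex x y : h (x - 1) y != h (x + 1) y.
  by apply/negP => ex; apply: noex; exists x, y.
have pW x y : h (x - 1) y != h x y by have := ph (x - 1) y; rewrite subrK.
have slope x y : h (x + 1) y - h x y = h 1 y - h 0 y.
  elim/int_step: x => [|x <-|x <-]; first by rewrite add0r.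
    by apply: Z3_progression => //; have := nex (x + 1) y; rewrite addrK.
  by rewrite subrK; apply/esym/Z3_progression.
pose apex z y := ((h z (y + 1) == h z y) || (h (z + 1) (y - 1) == h z y)) &&
      ((h z (y + 1) == h (z + 1) y) || (h (z + 1) (y - 1) == h (z + 1) y)).
have ends z y : h (z - 1) y = h (z + 2) y.
  have z2 : z + 2 = z + 1 + 1 by rewrite -addrA.
  have n1 := nex (z + 1) y; rewrite addrK -z2 in n1.
  apply: (@Z3_third (h z y) (h (z + 1) y)); rewrite ?nex ?pW //.
    by rewrite eq_sym.
  by rewrite z2 eq_sym.
have [[z [y good]]|bad] := boolp.EM (exists z y, ~~ apex z y).
  (* After the swap [z + 1] has the former color of [z], which is also that of [z + 3]. *)
  have [h' [s' h'z h'z1 h'E]] := pstate_swap sh (ends z y) good.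
  exists h', (z + 2), y; split=> //; rewrite /extremum.
  have -> : z + 2 - 1 = z + 1 by clear; lia.
  have -> : z + 2 + 1 = z + 3 by clear; lia.
  rewrite h'z1 h'E; [|site_dec..].
  have := ends (z + 1) y; rewrite addrK => ->.
  by have -> : z + 1 + 2 = z + 3 by clear; lia.
have {}bad z y : apex z y.
  by apply/contraT => good; case: bad; exists z, y.
pose s := h 1 0 - h 0 0; pose t z y := h z (y + 1) - h z y.
(* Both middle colors must occur at the two apexes, so the upper apex has one of them. *)
have tz z y : t z y = 0 \/ t z y = h 1 y - h 0 y.
  have := bad z y; rewrite /apex -(slope z y) /t.
  have := ph z y; set a := h z y; set b := h (z + 1) y; set u := h z (y + 1).
  move=> ab /andP[/orP[/eqP->|/eqP e1] /orP[/eqP e2|/eqP e2]].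
  - by left; rewrite subrr.
  - by left; rewrite subrr.
  - by right; rewrite e2.
  - by move: ab; rewrite -e1 -e2 eqxx.
have tstep z y : t (z + 1) y - t z y = (h 1 (y + 1) - h 0 (y + 1)) - (h 1 y - h 0 y).
  by rewrite -(slope z y) -(slope z (y + 1)) /t; ring.
(* Three consecutive vertical steps form a progression whose difference is the change of slope
   between the rows. *)
have sc y : h 1 (y + 1) - h 0 (y + 1) = h 1 y - h 0 y.
  exact: Z3_progression_avoids (tz 0 y) (tz (0 + 1) y) (tz (0 + 1 + 1) y)
    (tstep 0 y) (tstep (0 + 1) y).
have sE y : h 1 y - h 0 y = s.
  elim/int_step: y => [//|y <-|y <-]; first exact: sc.
  by rewrite -(sc (y - 1)) subrK.
have s0 : s != 0 by rewrite subr_eq0 eq_sym; have := ph 0 0; rewrite add0r.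
have tc z y : t z y = t 0 y.
  have st z' : t (z' + 1) y = t z' y by apply/eqP; rewrite -subr_eq0 tstep sc subrr.
  elim/int_step: z => [//|z <-|z <-]; first exact: st.
  by rewrite -st subrK.
have hs x y : h (x + 1) y = h x y + s by rewrite -(sE y) -(slope x y) [RHS]addrC subrK.
(* The lower apex has the middle color that the upper one leaves, which ties the vertical steps
   below and above the row. *)
have ty y : t 0 y = t 0 (y - 1).
  have := bad 0 y; rewrite /apex.
  have -> : h 0 (y + 1) = h 0 y + t 0 y by rewrite /t [RHS]addrC subrK.
  have -> : h (0 + 1) (y - 1) = h 0 y + s - t 0 (y - 1).
    by rewrite hs /t subrK; ring.
  rewrite hs; have := tz 0 y; have := tz 0 (y - 1); rewrite !sE.
  move: (t 0 y) (t 0 (y - 1)) (h 0 y) => t0' t1' b [->|->] [->|->] //; move: s0.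
    by case: (Z3_cases b) => ->; case: (Z3_cases s) => ->.
  by case: (Z3_cases b) => ->; case: (Z3_cases s) => ->.
have t_const y : t 0 y = t 0 0.
  elim/int_step: y => [//|y <-|y <-]; last by rewrite -ty.
  by rewrite ty addrK.
have ht x y : h x (y + 1) = h x y + t 0 0.
  by rewrite -(t_const y) -(tc x y) /t [RHS]addrC subrK.
have [k rk] := rh; have [L [cL Lh _]] := rk.
have := reachable_not_crystal rk cL; rewrite (lifts_crystal Lh hs ht) //.
- by have := tz 0 0; move: s0; rewrite sE => + [->|->]; case: (Z3_cases s) => ->.
- by have := tz 0 0; move: s0; rewrite sE => + [->|->]; case: (Z3_cases s) => ->.
- by have := tz 0 0; move: s0; rewrite sE => + [->|->]; case: (Z3_cases s) => ->.
Qed.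

(** Zeros and ones alternate; the last entry becomes -1 if it would equal [al], the first height of
    the next period. *)
Definition target_row (al : 'Z_3) (j : nat) : 'Z_3 :=
  if j == m.-1 then (if (odd j)%:R == al then -1 else (odd j)%:R) else (odd j)%:R.

Lemma target_row_proper al j : (j.+1 < m)%N -> target_row al j != target_row al j.+1.
Proof.
move=> jm; rewrite /target_row (_ : j == m.-1 = false); last by move: jm; clear; lia.
by rewrite /=; case: (odd j); case: (_ == m.-1) => //=; case: (_ == al).
Qed.

Lemma target_row_last al : target_row al m.-1 != target_row al 0 + al.
Proof.
rewrite /target_row eqxx (_ : 0%N == m.-1 = false) /=; last by move: m_gt; clear; lia.
rewrite add0r; case: ifP => [/eqP<-|/negbT//].
by case: (odd _).
Qed.

(** Rows are written downwards: each uses an extremum of the row above and, once written, has one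
    itself at column 1. *)
Lemma reach_target h al : horizontal_twist al -> pstate h ->
  exists h', pstate h' /\
    forall i j : nat, (i < m)%N -> (j < n)%N -> h' i j = target_row al i.
Proof.
move=> tw sh; have [h0 [x [y [s0 ex]]]] := extremum_exists sh.
have row h1 x1 y1 : pstate h1 -> extremum h1 x1 (y1 + 1) ->
    exists h', [/\ pstate h', extremum h' 1 y1,
      forall i : nat, (i < m)%N -> h' i%:Z y1 = target_row al i &
      forall u v, ~~ (n %| v - y1)%Z -> h' u v = h1 u v].
  move=> s1 e1.
  have [h' [s' h'g o']] := set_row tw s1 e1 (@target_row_proper al) (target_row_last
    al).
  have m2 : (2 < m)%N by apply: leq_trans m_gt.
  have e0 : h' (1 - 1) y1 = target_row al 0 by apply: (h'g 0%N); apply: ltnW (ltnW m2).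
  have e2 : h' (1 + 1) y1 = target_row al 2 by exact: (h'g 2%N m2).
  have m02 : target_row al 0 = target_row al 2.
    rewrite /target_row; have -> : (0%N == m.-1) = false by move: m_gt; clear; lia.
    by have -> : (2%N == m.-1) = false by move: m_gt; clear; lia.
  by exists h'; split=> //; rewrite /extremum e0 e2 m02.
(* Adding periods places the initial extremum in row [n] or higher, so that the descent can finish
   with the rows [n - 1] to 0. *)
have [k [h1 [x1 [s1 e1]]]] : exists (k : nat) h1 x1, pstate h1 /\ extremum h1 x1 (n%:Z
  + k%:Z).
  exists `|(y + (`|y| + 1) * n%:Z - n%:Z)%R|%N, h0, x; split=> //.
  rewrite -(extremum_periodic (u := x) (v := y)) //; first by case: s0.
  set K := `|y| * n%:Z; rewrite mulrDl mul1r -/K addrA addrK.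
  have yK : `|y| <= K by rewrite ler_peMr //; move: n_gt; clear; lia.
  have -> : n%:Z + `|(y + K)%R|%N%:Z = y + (`|y| + 1) * n%:Z.
    by rewrite mulrDl mul1r -/K; clearbody K; move: yK; clear; lia.
  apply/eqP; rewrite site_eq subrr dvdz0 /= opprD addrA subrr sub0r rpredN.
  exact: dvdz_mull.
have [h2 [x2 [s2 e2]]] : exists h2 x2, pstate h2 /\ extremum h2 x2 n%:Z.
  elim: k h1 x1 s1 e1 => [|k IH] h1 x1 s1 e1; first by exists h1, x1;
    rewrite addr0 in e1.
  have [|h' [s' e' _ _]] := row h1 x1 (n%:Z + k%:Z) s1.
    by have <- : n%:Z + k.+1%:Z = n%:Z + k%:Z + 1 by clear; lia.
  exact: IH s' e'.
have sweep (j : nat) : (j <= n)%N -> exists h' x', [/\ pstate h', extremum h' x' (n -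
  j)%N%:Z &
    forall i k : nat, (i < m)%N -> (n - j <= k < n)%N -> h' i%:Z k%:Z = target_row al
      i].
  elim: j => [_|j IH jn].
    exists h2, x2; split; rewrite ?subn0 // => i k' _.
    by move: (k'); clear; lia.
  have [h3 [x3 [s3 e3 h3g]]] := IH (ltnW jn).
  have [|h4 [s4 e4 h4g o4]] := row h3 x3 (n - j.+1)%N%:Z s3.
    by have -> : (n - j.+1)%N%:Z + 1 = (n - j)%N%:Z by move: jn; clear; lia.
  exists h4, 1; split=> // i k' im kn.
  case: (eqVneq k' (n - j.+1)%N) => [->|kj]; first exact: h4g.
  have nv : ~~ (n %| k'%:Z - (n - j.+1)%N%:Z)%Z.
    have -> : k'%:Z - (n - j.+1)%N%:Z = (k' - (n - j.+1))%N%:Z.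
      by move: kn kj jn; clear; lia.
    by rewrite dvdzE /= gtnNdvd //; move: kn kj jn; clear; lia.
  by rewrite (o4 _ _ nv); apply: h3g => //; move: kn kj jn; clear; lia.
have [h3 [_ [s3 _ h3g]]] := sweep n (leqnn n).
by exists h3; split=> // i j im jn; apply: h3g; rewrite // subnn jn.
Qed.

(** An equal horizontal pair at a minimum of [zeros] would connect [L0] to a crystal, and crystals
    are isolated. *)
Lemma pstate_exists : exists h, pstate h.
Proof.
case: (@arg_minnP _ L0 (connect (@one_hexagon_move m n) L0) zeros (connect0 _ _)) => L
  cL Lmin.
have [h Lh] := lifts_exist (connect_loops cL).
have rh : reach h (zeros L) by exists L.
exists h; split=> [|x y]; first by exists (zeros L).
apply/eqP => e; have [|C cC crC] := @min_zero_crystal (zeros L) _ h x y rh e.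
  by move=> h' k [L' [/Lmin + _ <-]].
by have := reachable_not_crystal rh cC; rewrite crC.
Qed.

End Component.

(** * Fluxes and the normal form of a configuration *)

Lemma Zp_trunc2 p : (20 < p)%N -> (Zp_trunc p).+2 = p.
Proof. by move=> p20; apply: Zp_cast; apply: leq_trans p20. Qed.

Lemma site_ord (i : 'Z_m) (j : 'Z_n) : site (i : nat)%:Z (j : nat)%:Z = (i, j).
Proof. by rewrite /site -!pmulrn !natr_Zp. Qed.

Lemma telescope_ord p (u : int -> 'Z_3) : (20 < p)%N ->
  \sum_(i < (Zp_trunc p).+2) (u ((i : nat)%:Z + 1) - u (i : nat)%:Z) = u p%:Z - u 0.
Proof.
move=> p20; rewrite -(big_mkord xpredT (fun i : nat => u (i%:Z + 1) - u i%:Z))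
  (Zp_trunc2 p20).
rewrite -(@telescope_sumr _ 0 p (fun i : nat => u i%:Z)) //.
by apply: eq_bigr => i _; have -> : i%:Z + 1 = i.+1%:Z by clear; lia.
Qed.

Lemma Nh_sum (L : config m n) : Nh L = \sum_(i : 'Z_m) L (ed (i, 0) t0).
Proof.
pose f (i : 'Z_m) := ed (i, 0) t0.
have f_inj : injective f by move=> i j /ed_inj[[]].
transitivity (\sum_(e in f @: setT) L e).
  apply: eq_bigl => e; apply/existsP/imsetP => [[i /eqP eE]|[i _ ->]]; exists i => //.
    by apply/val_inj; rewrite eE val_ed; congr [set _; _]; congr (_, _); rewrite addr0.
  by rewrite val_ed; apply/eqP; congr [set _; _]; congr (_, _); rewrite addr0.
rewrite big_imset /=; last exact: in2W.
by apply: eq_bigl => i; rewrite inE.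
Qed.

Lemma Nv_sum (L : config m n) : Nv L = \sum_(j : 'Z_n) L (ed (0, j) t1).
Proof.
pose f (j : 'Z_n) := ed (0, j) t1.
have f_inj : injective f by move=> i j /ed_inj[[]].
transitivity (\sum_(e in f @: setT) L e).
  apply: eq_bigl => e; apply/existsP/imsetP => [[i /eqP eE]|[i _ ->]]; exists i => //.
    by apply/val_inj; rewrite eE val_ed; congr [set _; _]; congr (_, _); rewrite addr0.
  by rewrite val_ed; apply/eqP; congr [set _; _]; congr (_, _); rewrite addr0.
rewrite big_imset /=; last exact: in2W.
by apply: eq_bigl => i; rewrite inE.
Qed.

Lemma NhE L h : lifts L h -> Nh L = h m%:Z 0 - h 0 0.
Proof.
move=> Lh; rewrite Nh_sum -(telescope_ord (fun i => h i 0) m_gt).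
apply: eq_bigr => i _; have [<- _ _] := Lh (i : nat)%:Z 0.
by have -> : site (i : nat)%:Z 0 = (i, 0) by exact: (site_ord i 0).
Qed.

Lemma NvE L h : lifts L h -> Nv L = h 0 0 - h 0 n%:Z.
Proof.
move=> Lh; rewrite Nv_sum -opprB -(telescope_ord (fun j => h 0 j) n_gt) -sumrN.
apply: eq_bigr => i _; have [_ + _] := Lh 0 (i : nat)%:Z; rewrite opprB => <-.
by have -> : site 0 (i : nat)%:Z = (0, i) by exact: (site_ord 0 i).
Qed.

(** The heights at two copies of a site receive the same increment, which cancels in the flux. *)
Lemma move_flux (L L' : config m n) : one_hexagon_move L L' -> Nh L' = Nh L /\ Nv L' =
  Nv L.
Proof.
move=> /moveP[lL _ [Q [d ->]]]; have [x [y ->]] := siteP Q.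
have [h Lh] := lifts_exist lL; have L'h' := recolor_lifts x y d Lh.
rewrite (NhE Lh) (NvE Lh) (NhE L'h') (NvE L'h').
have -> : site m%:Z 0 = site 0 0.
  by apply/eqP; rewrite site_eq !subr0 dvdzz dvdz0.
have -> : site 0 n%:Z = site 0 0.
  by apply/eqP; rewrite site_eq !subr0 dvdzz dvdz0.
by split; ring.
Qed.

Lemma connect_flux (L L' : config m n) : connect (@one_hexagon_move m n) L L' ->
  Nh L' = Nh L /\ Nv L' = Nv L.
Proof.
move=> /connectP[s + ->];
  elim: s L => //= L1 s IH L /andP[/move_flux[e1 e2] /IH[-> ->]].
by rewrite e1 e2.
Qed.

(** The edge values of heights equal to [target_row] in every row of the fundamental window; the
    fluxes enter where a coordinate wraps around. *)
Definition target_conf (al be : 'Z_3) : config m n :=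
  conf_of (fun p t =>
    let x := (if (p.1.+1 == m)%N then al else target_row al p.1.+1) - target_row al p.1
      in
    let y := if (p.2.+1 == n)%N then be else 0 in
    [:: x; y; - (x + y)]`_t).

Lemma connect_target (L : config m n) : L \in loops m n -> L \notin crystals m n ->
  connect (@one_hexagon_move m n) L (target_conf (Nh L) (Nv L)).
Proof.
move=> lL nL; set al := Nh L; set be := Nv L.
have flux h : reachable L h -> h m%:Z 0 - h 0 0 = al /\ h 0 0 - h 0 n%:Z = be.
  move=> [k [L' [/connect_flux[eh ev] L'h _]]].
  by rewrite /al /be -eh -ev (NhE L'h) (NvE L'h).
clearbody al be.
have sm : site m%:Z 0 = site 0 0.
  by apply/eqP; rewrite site_eq !subr0 dvdzz dvdz0.
have sn : site 0 n%:Z = site 0 0.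
  by apply/eqP; rewrite site_eq !subr0 dvdzz dvdz0.
have tw : horizontal_twist L al.
  move=> h rh x y; have [ealpha _] := flux h rh; rewrite -ealpha;
    have [k [L' [_ L'h _]]] := rh.
  have := lifts_trans L'h sm x y; rewrite add0r !add0r => /(canRL (subrK _)).
  by rewrite addrC => ->; ring.
have tv h : reachable L h -> forall x y, h x (y + n%:Z) = h x y - be.
  move=> rh x y; have [_ ebeta] := flux h rh; rewrite -ebeta;
    have [k [L' [_ L'h _]]] := rh.
  have := lifts_trans L'h sn x y; rewrite !add0r => /(canRL (subrK _)).
  by rewrite (addrC y) => ->; ring.
have [h sh] := pstate_exists lL nL.
have [h' [[rh' ph'] h'g]] := reach_target lL nL tw sh.
have [k [L' [cL' L'h' _]]] := rh'; suff <- : L' = target_conf al be by [].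
have gS i j : (i < m)%N -> (j < n)%N ->
    h' (i%:Z + 1) j%:Z = if i.+1 == m then al else target_row al i.+1.
  move=> im jn; have -> : i%:Z + 1 = i.+1%:Z by clear; lia.
  case: eqP => [->|/eqP iSm]; last by apply: h'g; rewrite // ltn_neqAle iSm.
  have := tw h' rh' 0 j%:Z; rewrite add0r => ->.
  rewrite (h'g 0%N) //; last exact: leq_trans m_gt.
  rewrite /target_row /= (_ : 0%N == m.-1 = false) ?add0r //; move: m_gt; clear; lia.
apply: conf_ext => -[i j] t; rewrite conf_ofE /=.
have im : (i < m)%N by rewrite -[X in (_ < X)%N](Zp_trunc2 m_gt).
have jn : (j < n)%N by rewrite -[X in (_ < X)%N](Zp_trunc2 n_gt).
have [e0 e1 e2] := L'h' (i : nat)%:Z (j : nat)%:Z.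
have e0' := e0; rewrite gS // h'g // site_ord in e0'.
have e1' : L' (ed (i, j) t1) = if j.+1 == n then be else 0.
  rewrite -site_ord e1; have -> : (j : nat)%:Z + 1 = j.+1%:Z by clear; lia.
  case: eqP => [->|/eqP jSn].
    have := tv h' rh' (i : nat)%:Z 0; rewrite add0r => ->.
    by rewrite h'g // (h'g _ 0%N) //; [ring|exact: leq_trans n_gt].
  by rewrite !h'g ?subrr // ltn_neqAle jSn.
case: (I3_cases t) => ->; [by rewrite e0'|by rewrite e1'|rewrite /=].
rewrite -e0' -e1'; have [+ _] := loopsP _ (connect_loops lL cL') (inl (i, j)).
by move=> /= /(canRL (addKr _)) ->; rewrite addr0.
Qed.

Lemma target_conf_edge al be p :
  target_conf al be (ed p t0) =
    (if (p.1.+1 == m)%N then al else target_row al p.1.+1) - target_row al p.1 /\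
  target_conf al be (ed p t1) = if (p.2.+1 == n)%N then be else 0.
Proof. by rewrite !conf_ofE. Qed.

Lemma target_row0 al : target_row al 0 = 0.
Proof. by rewrite /target_row /= (_ : (0%N == m.-1) = false) //; move: m_gt; clear;
  lia. Qed.

Lemma target_conf_loops al be : target_conf al be \in loops m n.
Proof.
(* Every vertex has a type 0 edge, so nonzero type 0 values exclude the all-zero vertices. *)
have nz (p : hexagon m n) : target_conf al be (ed p t0) != 0.
  have [-> _] := target_conf_edge al be p; rewrite subr_eq0.
  have pm : (p.1 < m)%N by rewrite -[X in (_ < X)%N](Zp_trunc2 m_gt).
  case: ifP => [/eqP pE|/negbT pSm].
    have -> : nat_of_ord p.1 = m.-1 by exact: (congr1 predn pE).
    by have := target_row_last al; rewrite target_row0 add0r eq_sym.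
  by rewrite eq_sym target_row_proper // ltn_neqAle pSm.
apply/loopsP => -[p|[i j]] /=; (split; last by rewrite (negPf (nz _))).
  by rewrite !conf_ofE /= subrr.
have e2 : (i, j) + a2 = (i, j + 1) :> hexagon m n by apply: (congr1 (pair^~ _));
  exact: addr0.
have e1 : (i, j) + a1 = (i + 1, j) :> hexagon m n by apply: (congr1 (pair _));
  exact: addr0.
by rewrite !shiftBE addr0 e1 e2 !conf_ofE /= subrr.
Qed.

Lemma target_conf_Nh al be : Nh (target_conf al be) = al.
Proof.
pose u (k : int) := if `|k|%N == m then al else target_row al `|k|%N.
transitivity (u m%:Z - u 0); last first.
  rewrite /u /= eqxx target_row0 (_ : (0%N == m) = false) ?subr0 //.
  by move: m_gt; clear; lia.
rewrite Nh_sum -(telescope_ord u m_gt); apply: eq_bigr => i _.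
rewrite (target_conf_edge al be _).1 /u [(_, _).1]/= absz_nat.
have im : (i < m)%N by rewrite -[X in (_ < X)%N](Zp_trunc2 m_gt).
rewrite (_ : (nat_of_ord i == m) = false); last by rewrite ltn_eqF.
by have -> : `|((i : nat)%:Z + 1)%R|%N = i.+1 by clear; lia.
Qed.

Lemma target_conf_Nv al be : Nv (target_conf al be) = be.
Proof.
pose u (k : int) := if `|k|%N == n then be else 0.
transitivity (u n%:Z - u 0); last first.
  rewrite /u /= eqxx (_ : (0%N == n) = false) ?subr0 //.
  by move: n_gt; clear; lia.
rewrite Nv_sum -(telescope_ord u n_gt); apply: eq_bigr => i _.
rewrite (target_conf_edge al be _).2 /u [(_, _).2]/= absz_nat.
have jn : (i < n)%N by rewrite -[X in (_ < X)%N](Zp_trunc2 n_gt).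
rewrite (_ : (nat_of_ord i == n) = false); last by rewrite ltn_eqF.
by have -> : `|((i : nat)%:Z + 1)%R|%N = i.+1; [clear; lia|rewrite subr0].
Qed.

Lemma target_conf_not_crystal al be : target_conf al be \notin crystals m n.
Proof.
apply/negP => /crystalsP[s _ Cs].
have := Cs (1, 0) t0; rewrite -(Cs (0, 0) t0).
rewrite !(target_conf_edge al be _).1.
have n1 : (1%N == m.-1) = false by move: m_gt; clear; lia.
have n2 : (2%N == m.-1) = false by move: m_gt; clear; lia.
have n3 : (1%N == m) = false by move: m_gt; clear; lia.
have n4 : (2%N == m) = false by move: m_gt; clear; lia.
rewrite /= modn_small // n3 n4 target_row0 /target_row n1 n2.
by move=> /eqP.
Qed.

Lemma crystals_loops C : C \in crystals m n -> C \in loops m n.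
Proof.
move=> /crystalsP[s inj Cs]; apply/loopsP => v.
have d01 : s t0 != s t1 by apply/eqP => /inj.
have d02 : s t0 != s t2 by apply/eqP => /inj.
have d12 : s t1 != s t2 by apply/eqP => /inj.
have vE t : C (vedge v t) = s t by case: v => p; apply: Cs.
rewrite !vE; split; [apply/eqP|]; move: d01 d02 d12;
by case: (Z3_cases (s t0)) => ->; case: (Z3_cases (s t1)) => ->;
  case: (Z3_cases (s t2)) => ->.
Qed.

Lemma card_crystals : #|crystals m n| = 6%N.
Proof.
pose f (s : {ffun 'I_3 -> 'Z_3}) := conf_of (fun _ t => s t).
have f_inj : injective f.
  move=> s s' E; apply/ffunP => t; have := congr1 (fun L : config m n => L (ed 0 t)) E.
  by rewrite !conf_ofE.
have -> : crystals m n = f @: [set s : {ffun 'I_3 -> 'Z_3} | injectiveb s].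
  apply/setP => C; apply/crystalsP/imsetP => [[s inj Cs]|[s]].
    exists (finfun s); last by apply: conf_ext => p t; rewrite conf_ofE ffunE Cs.
    by rewrite inE; apply/injectiveP => t t'; rewrite !ffunE => /inj.
  rewrite inE => /injectiveP inj ->; exists s => // p t; exact: conf_ofE.
by rewrite card_imset // card_inj_ffuns !card_ord.
Qed.

Lemma connect_noncrystals (L L' : config m n) :
  L \in loops m n -> L \notin crystals m n ->
  L' \in loops m n -> L' \notin crystals m n ->
  Nh L = Nh L' -> Nv L = Nv L' -> connect (@one_hexagon_move m n) L L'.
Proof.
move=> lL nL lL' nL' eh ev; apply: connect_trans (connect_target lL nL) _.
by rewrite eh ev connect_move_sym; exact: connect_target.
Qed.

(** * The kernel of the Hamiltonian *)

Section Kernel.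
Local Open Scope complex_scope.
Variables (R : realType) (zeta : R).
Hypothesis zeta_gt0 : 0 < zeta.
Local Notation z := (zeta%:C).
Implicit Type P : hexagon m n.

Lemma z_neq0 : z != 0 :> R[i].
Proof. by rewrite eq_complex /= negb_and gt_eqF. Qed.

Lemma card_edge (e : edge m n) : #|val e| = 2%N.
Proof.
have [p [t ->]] := ed_surj e; have [x [y ->]] := siteP p.
by case: (I3_cases t) => ->; rewrite val_ed cards2 ?siteE; congr (_.+1); site_dec.
Qed.

Lemma card_triple (v : vertex m n) : (#|triple v| <= 3)%N.
Proof.
have c3 (a b c : hexagon m n) : (#|[set a; b; c]| <= 3)%N.
  by rewrite setUC cardsU1 cards2; case: (_ \notin _); case: (_ != _).
by case: v => p; apply: c3.
Qed.

(** By cardinality, an edge at [v] that avoids [P] is the triple of [v] with [P] removed. *)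
Lemma outer_leg_unique P (v : vertex m n) (e e' : edge m n) : v \in hex_vertices P -> e
  \in star v ->
  e' \in star v -> e \notin hex_edges P -> e' \notin hex_edges P -> e = e'.
Proof.
rewrite !inE => Pv ev e'v Pe Pe'.
have vE (f : edge m n) : val f \subset triple v -> P \notin val f -> val f = triple v
  :\ P.
  move=> fv Pf; apply/eqP; rewrite eqEcard subsetD1 fv Pf card_edge.
  by have := card_triple v; rewrite (cardsD1 P) Pv.
by apply: val_inj; rewrite (vE e ev Pe) (vE e' e'v Pe').
Qed.

Lemma star_hex P (v : vertex m n) (e : edge m n) : v \in hex_vertices P -> e \in star v
  ->
  (e \in hex_edges P) || (e \in outer_legs P).
Proof.
move=> vP ev; case: (boolP (e \in hex_edges P)) => //= eP; rewrite inE eP /=.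
by apply/existsP; exists v; rewrite vP.
Qed.

Lemma star_off_hex P (v : vertex m n) (e : edge m n) : v \notin hex_vertices P -> e \in
  star v -> e \notin hex_edges P.
Proof. by rewrite !inE => Pv /subsetP ev; apply: contra Pv => /ev. Qed.

Lemma restr_star_join P (v : vertex m n) (r : asg (outer_legs P)) (x : asg (hex_edges
  P)) (L : config m n) :
  v \in hex_vertices P -> r = restr (outer_legs P) L ->
  restr (star v) (join_legs r x) = restr (star v) (patch x L).
Proof.
move=> vP rE; apply/ffunP => -[e ev]; rewrite [LHS]ffunE [RHS]ffunE /join_legs /=.
have := star_hex vP ev; case: (boolP (e \in hex_edges P)) => [eP _|eP /= eo].
  by rewrite !(patch_mem _ _ eP).
by rewrite !(patch_out _ _ eP) (patch_mem _ _ eo) rE ffunE.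
Qed.

Lemma restr_star_off P (v : vertex m n) (L L' : config m n) : v \notin hex_vertices P ->
  (forall e, e \notin hex_edges P -> L' e = L e) -> restr (star v) L' = restr (star v)
    L.
Proof.
move=> vP off; apply/ffunP => -[e ev]; rewrite !ffunE /=; apply: off.
exact: star_off_hex vP ev.
Qed.

Lemma sum_restr (S : {set edge m n}) (L : config m n) :
  \sum_(e : {e | e \in S}) restr S L e = \sum_(e in S) L e.
Proof. by under eq_bigr => e _ do rewrite ffunE; rewrite -(big_sub S L). Qed.

(** At each vertex of [P] the zero-sum rule recovers the outer leg from the two hexagon edges. Hence
    distinct [chi] have disjoint supports. *)
Lemma Xset_disjoint P (r r' : asg (outer_legs P)) (x : asg (hex_edges P)) :
  x \in Xset r -> x \in Xset r' -> r = r'.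
Proof.
rewrite !inE => /forallP Xr /forallP Xr'; apply/ffunP => -[e eo].
have := eo; rewrite inE => /andP[eP /existsP[v /andP[vP ev]]].
have := implyP (Xr v) vP; have := implyP (Xr' v) vP.
rewrite /allowed !sum_restr => /andP[/eqP s' _] /andP[/eqP s _].
have joinE q : join_legs q x e = q (exist (fun e => e \in outer_legs P) e eo).
  rewrite /join_legs patch_out //.
  by rewrite (patch_mem _ _ eo).
rewrite -!joinE; move: s s'; rewrite (bigD1 e) //= [X in _ -> X = 0 -> _](bigD1 e) //=.
set S1 := \sum_(_ | _) _; set S2 := \sum_(_ | _) _.
suff <- : S1 = S2 by move=> + /(canRL (addrK _)) -> => /(canRL (addrK _)) ->.
apply: eq_bigr => f /andP[fv fe]; rewrite /join_legs.
have fP : f \in hex_edges P.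
  by apply: contraNT fe => fP; apply/eqP; apply: outer_leg_unique vP fv ev fP eP.
by rewrite !(patch_mem _ _ fP).
Qed.

Lemma Xset_allowed P (L : config m n) (x : asg (hex_edges P)) :
  (x \in Xset (restr (outer_legs P) L)) =
  [forall v in hex_vertices P, allowed (restr (star v) (patch x L))].
Proof.
rewrite inE; apply: eq_forallb => v; case: (boolP (v \in _)) => //= vP.
by rewrite (restr_star_join x vP (erefl _)).
Qed.

(** Vertices off [P] do not see the patch, so their conditions are inherited from [patch y L]. *)
Lemma loops_patch P (L : config m n) (x y : asg (hex_edges P)) :
  patch y L \in loops m n ->
  (patch x L \in loops m n) = (x \in Xset (restr (outer_legs P) L)).
Proof.
rewrite Xset_allowed [patch x L \in _]inE inE => /forallP lL;
  apply/forallP/forallP => h v.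
  by apply/implyP => _.
case: (boolP (v \in hex_vertices P)) => vP; first exact: implyP (h v) vP.
rewrite (restr_star_off (L := patch y L) vP) // => e eP.
by rewrite !patch_out.
Qed.

Definition weight (L : config m n) : nat := (NA222 L + NB111 L)%N.

Lemma weightE (L : config m n) : weight L = (\sum_v weighted (restr (star v) L))%N.
Proof.
have wE v (c : 'Z_3) : [forall e : {e | e \in star v}, restr (star v) L e == c]
    = [forall e in star v, L e == c].
  apply/forallP/forallP => h e.
    apply/implyP => ev; have := h (exist (fun e => e \in star v) e ev).
    by rewrite ffunE.
  by rewrite ffunE; case: e => e ev; exact: implyP (h e) ev.
rewrite big_sumType /weight /NA222 /NB111 -!sum1dep_card.
by congr (_ + _)%N; rewrite [LHS]big_mkcond /=; apply: eq_bigr => p _;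
  rewrite /weighted wE; case: [forall e in _, _].
Qed.

Definition hex_weighted P (L : config m n) : nat :=
  (\sum_(v in hex_vertices P) weighted (restr (star v) L))%N.

Lemma weight_hex P (L L' : config m n) : (forall e, e \notin hex_edges P -> L' e = L e)
  ->
  (weight L' + hex_weighted P L = weight L + hex_weighted P L')%N.
Proof.
move=> off; rewrite !weightE (bigID (mem (hex_vertices P))) /=.
rewrite [in RHS](bigID (mem (hex_vertices P))) /= -/(hex_weighted P _) -/(hex_weighted
  P _).
rewrite (eq_bigr (fun v => nat_of_bool (weighted (restr (star v) L)))); first by ring.
by move=> v vP; rewrite (restr_star_off vP off).
Qed.

Lemma hex_weightE P (L : config m n) (x : asg (hex_edges P)) :
  hex_weight zeta (restr (outer_legs P) L) x = z ^+ hex_weighted P (patch x L).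
Proof.
rewrite /hex_weight /hex_weighted; congr (_ ^+ _).
rewrite -sum1dep_card big_mkcondr; apply: eq_bigr => v vP.
by rewrite (restr_star_join x vP (erefl _)); case: weighted.
Qed.

(** * Kernels of the local terms *)

Lemma ketE (T : finType) (x y : T) : ket R x y = (y == x)%:R.
Proof. by rewrite ffunE. Qed.

Lemma inner_ket (T : finType) (x : T) (phi : state R T) : inner (ket R x) phi = phi x.
Proof.
rewrite /inner (bigD1 x) //= ketE eqxx rmorph1 mul1r big1 ?addr0 // => y yx.
by rewrite ketE (negPf yx) rmorph0 mul0r.
Qed.

Lemma ket_sumE (T : finType) (A : {pred T}) (a : T -> R[i]) x :
  (\sum_(y in A) a y *: ket R y) x = if x \in A then a x else 0.
Proof.
rewrite sum_ffunE.
have e y : (a y *: ket R y) x = if y == x then a y else 0.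
  rewrite stateZE ketE (eq_sym x y); case: (y == x); first exact: mulr1.
  exact: mulr0.
under eq_bigr => y _ do rewrite e.
rewrite -big_mkcondr; case: ifP => xX.
  by rewrite (big_pred1 x) // => y /=; case: (eqVneq y x) => [->|_]; rewrite ?xX ?andbF.
by rewrite big_pred0 // => y; case: (eqVneq y x) => [->|_]; rewrite ?xX ?andbF.
Qed.

Definition unnormalized P (r : asg (outer_legs P)) : state R (asg (hex_edges P)) :=
  \sum_(x in Xset r) hex_weight zeta r x *: ket R x.

Lemma unnormalizedE P (r : asg (outer_legs P)) x :
  unnormalized r x = if x \in Xset r then hex_weight zeta r x else 0.
Proof. exact: ket_sumE. Qed.

Lemma hex_weight_neq0 P (r : asg (outer_legs P)) x : hex_weight zeta r x != 0.
Proof. by rewrite expf_neq0 // z_neq0. Qed.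

Lemma chi_ortho P (r r' : asg (outer_legs P)) : Xset r != set0 -> Xset r' != set0 ->
  inner (chi zeta r) (chi zeta r') = (r == r')%:R.
Proof.
move=> r0 _; rewrite /chi -/(unnormalized r) -/(unnormalized r') /normalize innerZr
  innerZl.
case: (eqVneq r r') => [<-|rr'].
  set c := inner _ _; have c0 : c != 0.
    have /set0Pn[x xX] := r0; apply: contraTneq isT => /inner_eq0 u0.
    have := unnormalizedE r x; rewrite u0 xX ffunE => /esym/eqP.
    by rewrite (negPf (hex_weight_neq0 _ _)).
  have cge0 : 0 <= c by apply: inner_ge0.
  rewrite geC0_conj ?invr_ge0 ?sqrtC_ge0 //.
  by rewrite mulrA -invfM -expr2 sqrtCK mulVf.
suff -> : inner (unnormalized r) (unnormalized r') = 0 by rewrite [X in _ * X]mulr0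
  mulr0.
rewrite /inner big1 // => x _; rewrite !unnormalizedE.
case: ifP => xr; last by rewrite conjC0 mul0r.
case: ifP => xr'; last exact: mulr0.
by rewrite (Xset_disjoint xr xr') eqxx in rr'.
Qed.

Lemma h_vertexE v : h_vertex R v = embed (coprojector (@allowed m n v) (ket R (T:=_))).
Proof. by []. Qed.

Lemma h_hexagonE P : h_hexagon zeta P =
  embed (coprojector (fun r : asg (outer_legs P) => Xset r != set0) (chi zeta (P:=P))).
Proof. by []. Qed.

Lemma ket_ortho (T : finType) (x y : T) : inner (ket R x) (ket R y) = (x == y)%:R.
Proof. by rewrite inner_ket ketE. Qed.

Lemma vertex_quad v phi : inner phi (coprojector (@allowed m n v) (ket R (T:=_)) phi) =
  inner (coprojector (@allowed m n v) (ket R (T:=_)) phi)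
        (coprojector (@allowed m n v) (ket R (T:=_)) phi).
Proof. by apply: coprojector_quad => x y _ _; exact: ket_ortho. Qed.

Lemma hexagon_quad P phi :
  inner phi (coprojector (fun r : asg (outer_legs P) => Xset r != set0) (chi zeta
    (P:=P)) phi) =
  inner (coprojector (fun r : asg (outer_legs P) => Xset r != set0) (chi zeta (P:=P))
    phi)
        (coprojector (fun r : asg (outer_legs P) => Xset r != set0) (chi zeta (P:=P))
          phi).
Proof. by apply: coprojector_quad => r r' Xr Xr'; exact: chi_ortho. Qed.

Lemma vertex_kernel v (psi : state R (config m n)) : h_vertex R v psi = 0 <->
  forall L, ~~ allowed (restr (star v) L) -> psi L = 0.
Proof.
have AE phi x : coprojector (@allowed m n v) (ket R (T:=_)) phi x = if allowed x then 0
  else phi x.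
  rewrite coprojectorE !ffunE.
  under eq_bigr => y _ do rewrite inner_ket.
  rewrite (ket_sumE (@allowed m n v) phi x) -[x \in _]/(allowed x).
  by case: (allowed x); rewrite ?subrr ?subr0.
rewrite h_vertexE; split=> [/embed_eq0 h L nL|h].
  have := congr1 (fun f : state R _ => f (restr (star v) L)) (h L).
  by rewrite /= AE (negPf nL) !ffunE patch_restr.
apply/embed_eq0 => L; apply/ffunP => x; rewrite AE [RHS]ffunE.
case: ifP => // /negbT nx; rewrite ffunE; apply: h.
by rewrite restr_patch.
Qed.

(** A slice in the kernel is a combination of the [chi r]. By disjointness of supports only [chi r0]
    meets [Xset r0], so there the slice is proportional to the hexagon weight. *)
Lemma hexagon_kernel_move P (psi : state R (config m n)) L L' :
  h_hexagon zeta P psi = 0 -> L \in loops m n -> L' \in loops m n ->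
  (forall e, e \notin hex_edges P -> L' e = L e) ->
  psi L * z ^+ weight L' = psi L' * z ^+ weight L.
Proof.
rewrite h_hexagonE => /embed_eq0/(_ L) + lL lL' off.
rewrite coprojectorE => /eqP; rewrite subr_eq0 => /eqP E.
pose r0 := restr (outer_legs P) L.
have [k kE] : exists k, forall x, x \in Xset r0 -> psi (patch x L) = k * hex_weight
  zeta r0 x.
  exists (inner (chi zeta r0) (slice (hex_edges P) psi L) * (sqrtC (inner (unnormalized
    r0) (unnormalized r0)))^-1).
  move=> x xX; have := congr1 (fun f : state R (asg (hex_edges P)) => f x) E.
  rewrite /= [LHS]ffunE => ->; rewrite sum_ffunE (bigD1 r0) /=; last first.
    by apply/set0Pn; exists x.
  rewrite big1 ?addr0 => [|r /andP[_ rr0]].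
    by rewrite /chi /normalize !stateZE -/(unnormalized r0) unnormalizedE xX mulrA.
  rewrite /chi /normalize !stateZE -/(unnormalized r) unnormalizedE.
  case: ifP => xr; last by rewrite !mulr0.
  by rewrite (Xset_disjoint xr xX) eqxx in rr0.
have pL : patch (restr (hex_edges P) L) L = L by apply: patch_restr.
have pL' : patch (restr (hex_edges P) L') L = L' by apply: patch_eq.
have kL : psi L = k * z ^+ hex_weighted P L.
  by rewrite -{1}pL kE ?hex_weightE ?pL // -(loops_patch _ (y := restr _ L)) pL.
have kL' : psi L' = k * z ^+ hex_weighted P L'.
  by rewrite -{1}pL' kE ?hex_weightE ?pL' // -(loops_patch _ (y := restr _ L')) pL'.
rewrite kL kL' -!mulrA -!exprD addnC (weight_hex off) addnC; congr (_ * _ ^+ _).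
Qed.

(** A nonzero slice contains a loop configuration [M]. All members of [Xset r0] are one move away
    from [M], so invariance makes the slice a multiple of [chi r0]. *)
Lemma hexagon_kernel_of_moves P (psi : state R (config m n)) :
  (forall L, L \notin loops m n -> psi L = 0) ->
  (forall L L', one_hexagon_move L L' -> psi L * z ^+ weight L' = psi L' * z ^+ weight
    L) ->
  h_hexagon zeta P psi = 0.
Proof.
move=> supp mv; rewrite h_hexagonE; apply/embed_eq0 => L.
case: (boolP [exists x, slice (hex_edges P) psi L x != 0]) => [/existsP[x0 nz]|];
  last first.
  rewrite negb_exists => /forallP h;
    suff -> : slice (hex_edges P) psi L = 0 by rewrite linear0.
  by apply/ffunP => x; rewrite [RHS]ffunE; apply/eqP; rewrite -[_ == _]negbK h.
rewrite ffunE in nz; set M := patch x0 L in nz.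
have lM : M \in loops m n by apply: contraNT nz => /supp ->.
pose r0 := restr (outer_legs P) L.
have x0X : x0 \in Xset r0 by rewrite -(loops_patch _ lM).
suff [k ->] : exists k, slice (hex_edges P) psi L = k *: chi zeta r0.
  have Xr0 : Xset r0 != set0 by apply/set0Pn; exists x0.
  by rewrite linearZ /= (coprojector_chi (@chi_ortho P) Xr0) scaler0.
pose N := sqrtC (inner (unnormalized r0) (unnormalized r0)).
have N0 : N != 0.
  rewrite sqrtC_eq0; apply/eqP => /inner_eq0 u0.
  have := unnormalizedE r0 x0; rewrite u0 x0X ffunE => /esym/eqP.
  by rewrite (negPf (hex_weight_neq0 _ _)).
exists (psi M / z ^+ hex_weighted P M * N); apply/ffunP => x.
rewrite [LHS]ffunE /chi /normalize !stateZE -/(unnormalized r0) -/N unnormalizedE.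
rewrite mulrA mulfK //; case: ifP => xX; last first.
  by rewrite mulr0 supp // (loops_patch _ lM) xX.
have lx : patch x L \in loops m n by rewrite (loops_patch _ lM).
have off e : e \notin hex_edges P -> patch x L e = M e by move=> eP; rewrite !patch_out.
have mvx : one_hexagon_move M (patch x L).
  rewrite /one_hexagon_move lM lx; apply/existsP; exists P; apply/forallP => e.
  by apply/implyP => eP; rewrite off.
rewrite hex_weightE; have zk k : z ^+ k != 0 by rewrite expf_neq0 ?z_neq0.
apply: (mulIf (zk (weight M))); rewrite -(mv _ _ mvx).
apply: (mulIf (zk (hex_weighted P M))).
rewrite -[LHS]mulrA -exprD (weight_hex off) exprD.
move: (zk (hex_weighted P M)).
move: (z ^+ hex_weighted P M) (z ^+ hex_weighted P (patch x L)) (z ^+ weight M) (psi M)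
  => a b c p a0.
by rewrite -!mulrA [b * (c * a)]mulrA [a^-1 * _]mulrC mulfK // (mulrC b).
Qed.

Lemma hamiltonianE (psi : state R (config m n)) : hamiltonian zeta m n psi =
  \sum_v h_vertex R v psi + \sum_P h_hexagon zeta P psi.
Proof. by rewrite add_lfunE !sum_lfunE. Qed.

Lemma h_vertex_ge0 v psi : 0 <= inner psi (h_vertex R (m:=m) (n:=n) v psi).
Proof. by rewrite h_vertexE; apply: embed_ge0; exact: vertex_quad. Qed.

Lemma h_hexagon_ge0 P psi : 0 <= inner psi (h_hexagon zeta P psi).
Proof. by rewrite h_hexagonE; apply: embed_ge0; exact: hexagon_quad. Qed.

Lemma hamiltonian_ge0 psi : 0 <= inner psi (hamiltonian zeta m n psi).
Proof.
rewrite hamiltonianE innerDr !inner_sumr.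
by apply: addr_ge0; apply: sumr_ge0 => i _; [exact: h_vertex_ge0|exact: h_hexagon_ge0].
Qed.

Lemma hamiltonian_kernel psi : hamiltonian zeta m n psi = 0 ->
  (forall v, h_vertex R v psi = 0) /\ (forall P, h_hexagon zeta P psi = 0).
Proof.
move=> H0; have : inner psi (hamiltonian zeta m n psi) = 0 by rewrite H0 inner0r.
have v0 v (_ : true) := h_vertex_ge0 v psi.
have p0 P (_ : true) := h_hexagon_ge0 P psi.
rewrite hamiltonianE innerDr !inner_sumr => /eqP.
rewrite paddr_eq0; [|exact: sumr_ge0..] => /andP[/eqP sv /eqP sp].
split=> i.
  rewrite h_vertexE; apply: embed_kernel; first exact: vertex_quad.
  by rewrite -h_vertexE; exact: (psumr_eq0P v0 sv).
rewrite h_hexagonE; apply: embed_kernel; first exact: hexagon_quad.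
by rewrite -h_hexagonE; exact: (psumr_eq0P p0 sp).
Qed.

(** Invariance of [psi] divided by its weight, in cross-multiplied form. *)
Definition move_invariant (psi : state R (config m n)) := forall L L',
  one_hexagon_move L L' -> psi L * z ^+ weight L' = psi L' * z ^+ weight L.

Lemma kernelP (psi : state R (config m n)) : psi \in lker (hamiltonian zeta m n) <->
  (forall L, L \notin loops m n -> psi L = 0) /\ move_invariant psi.
Proof.
rewrite memv_ker; split=> [/eqP/hamiltonian_kernel[hv hp]|[supp mv]].
  split=> [L|L L' /and3P[lL lL' /existsP[P /forallP off]]].
    rewrite inE negb_forall => /existsP[v nv].
    exact: (vertex_kernel v psi).1 (hv v) L nv.
  apply: (hexagon_kernel_move (P := P)) => // e eP.
  by apply/eqP; exact: implyP (off e) eP.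
rewrite hamiltonianE; apply/eqP; rewrite !big1 ?addr0 // => [P _|v _].
  exact: hexagon_kernel_of_moves.
apply/vertex_kernel => L nv; apply: supp; rewrite inE negb_forall.
by apply/existsP; exists v.
Qed.

Lemma move_invariant_connect psi L L' : move_invariant psi ->
  connect (@one_hexagon_move m n) L L' -> psi L * z ^+ weight L' = psi L' * z ^+ weight
    L.
Proof.
move=> mv /connectP[s + ->]; elim: s L => //= L1 s IH L /andP[/mv e1 /IH e2].
have zk k : z ^+ k != 0 by rewrite expf_neq0 ?z_neq0.
apply: (mulIf (zk (weight L1))).
by rewrite mulrAC e1 mulrAC e2 mulrAC.
Qed.

(** * The fifteen ground states *)

Lemma PsiE (nuh nuv : 'I_3) (L : config m n) : Psi zeta m n nuh nuv L = if L \in loops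
  m n then
  omega R ^+ (nuh * Nh L + nuv * Nv L)%N * z ^+ weight L else 0.
Proof. exact: ket_sumE. Qed.

Lemma Psi_kernel (nuh nuv : 'I_3) : Psi zeta m n nuh nuv \in lker (hamiltonian zeta m
  n).
Proof.
apply/kernelP; split=> [L /negPf nL|L L' mv]; first by rewrite PsiE nL.
have [eh ev] := move_flux mv; have /and3P[lL lL' _] := mv.
by rewrite !PsiE lL lL' eh ev mulrAC.
Qed.

Lemma crystal_kernel C : C \in crystals m n -> ket R C \in lker (hamiltonian zeta m n).
Proof.
move=> cC; apply/kernelP; split=> [L nL|L L' mv]; rewrite !ketE.
  by case: eqP => // LC; rewrite LC crystals_loops in nL.
case: (eqVneq L C) => [LC|nLC].
  by rewrite LC in mv *; rewrite (crystal_isolated cC mv) eqxx.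
case: (eqVneq L' C) => [LC|nLC']; last by rewrite !mul0r.
rewrite LC move_sym in mv.
by rewrite (crystal_isolated cC mv) eqxx in nLC.
Qed.

Lemma Psi_in_states (a b : 'I_3) :
  Psi zeta m n a b \in Psi_states zeta m n ++ crystal_states R m n.
Proof.
by rewrite mem_cat; apply/orP; left; apply/allpairsP; exists (a, b); rewrite !mem_enum.
Qed.

Lemma crystal_in_states C : C \in crystals m n ->
  ket R C \in Psi_states zeta m n ++ crystal_states R m n.
Proof. by move=> cC; rewrite mem_cat map_f ?orbT // mem_enum. Qed.

(** Fourier coefficients of the quotients at the configurations [target_conf] give a combination [Q]
    of the [Psi] that agrees with [psi] off the crystals; the remainder is a sum of crystal kets. *)
Lemma kernel_span :
  lker (hamiltonian zeta m n) = <<Psi_states zeta m n ++ crystal_states R m n>>%VS.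
Proof.
apply/eqP; rewrite eqEsubv; apply/andP; split; last first.
  apply/span_subvP => u; rewrite mem_cat => /orP[/allpairsP[p [_ _ ->]]|/mapP[C]].
    exact: Psi_kernel.
  by rewrite mem_enum => cC ->; exact: crystal_kernel.
apply/subvP => psi /kernelP[supp mv].
have zk k : z ^+ k != 0 by rewrite expf_neq0 ?z_neq0.
pose f (a b : 'I_3) := psi (target_conf a b) / z ^+ weight (target_conf a b).
pose Q : state R (config m n) := \sum_a \sum_b dft2 f a b *: Psi zeta m n a b.
have QE L : L \in loops m n -> Q L = f (Nh L) (Nv L) * z ^+ weight L.
  move=> lL; rewrite -dft2K /Q sum_ffunE mulr_suml; apply: eq_bigr => a _.
  rewrite sum_ffunE mulr_suml; apply: eq_bigr => b _.
  by rewrite stateZE PsiE lL mulrA.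
have Q0 L : L \notin loops m n -> Q L = 0.
  move=> nL; rewrite /Q sum_ffunE big1 // => a _; rewrite sum_ffunE big1 // => b _.
  by rewrite stateZE PsiE (negPf nL) mulr0.
have -> : psi = Q + \sum_(C in crystals m n) (psi - Q) C *: ket R C.
  apply/ffunP => L; rewrite [RHS]ffunE ket_sumE; case: ifP => cL.
    by rewrite !ffunE addrC subrK.
  rewrite addr0; case: (boolP (L \in loops m n)) => lL; last by rewrite Q0 // supp.
  have := move_invariant_connect mv (connect_target lL (negbT cL)).
  rewrite QE // /f => e; apply: (mulIf (zk (weight (target_conf (Nh L) (Nv L))))).
  by rewrite e mulrAC mulfVK.
apply: rpredD; apply: rpred_sum => a aP; last first.
  by rewrite memvZ // memv_span // crystal_in_states.
by apply: rpred_sum => b _; rewrite memvZ // memv_span // Psi_in_states.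
Qed.

(** At the noncrystalline [target_conf i j] the crystal kets vanish and a Fourier sum remains, so
    the [Psi] coefficients are 0; evaluation at a crystal then gives its coefficient. *)
Lemma states_free : free (Psi_states zeta m n ++ crystal_states R m n).
Proof.
pose F (i : ('I_3 * 'I_3) + config m n) : state R (config m n) :=
  match i with inl p => Psi zeta m n p.1 p.2 | inr C => ket R C end.
pose s : seq (('I_3 * 'I_3) + config m n) :=
  [seq inl (a, b) | a <- enum 'I_3, b <- enum 'I_3] ++ [seq inr C | C <- enum (crystals
    m n)].
have -> : Psi_states zeta m n ++ crystal_states R m n = map F s.
  by rewrite map_cat map_allpairs; congr (_ ++ _); rewrite -[RHS]map_comp.
apply: free_map => [|k].
  rewrite cat_uniq map_inj_uniq ?enum_uniq ?andbT; last by move=> ? ? [].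
  apply/andP; split; first by apply: allpairs_uniq;
    rewrite ?enum_uniq // => -[? ?] [? ?] _ _ [-> ->].
  by apply/hasPn => _ /mapP[C _ ->]; apply/negP => /allpairsP[p [_ _]].
rewrite [\sum_(i <- s) _](_ : _ = \sum_(a : 'I_3) \sum_(b : 'I_3) k (inl (a, b)) *: Psi
  zeta m n a b
    + \sum_(C in crystals m n) k (inr C) *: ket R C); last first.
  rewrite /s big_cat /=; congr (_ + _); last by rewrite big_map big_enum.
  by rewrite big_allpairs_dep big_enum; apply: eq_bigr => a _; rewrite big_enum.
move=> k0.
have {k0} kE L : \sum_(a : 'I_3) \sum_(b : 'I_3) k (inl (a, b)) * Psi zeta m n a b L
    + (if L \in crystals m n then k (inr L) else 0) = 0.
  have := congr1 (fun u : state R (config m n) => u L) k0.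
  rewrite /= !ffunE (ket_sumE (crystals m n) (fun C => k (inr C))) => e.
  rewrite -[RHS]e; congr (_ + _).
  rewrite sum_ffunE; apply: eq_bigr => a _; rewrite sum_ffunE.
  by apply: eq_bigr => b _; rewrite stateZE.
have kinl a b : k (inl (a, b)) = 0.
  move: a b; apply: dft2_inj => i j; have := kE (target_conf i j).
  rewrite (negPf (target_conf_not_crystal i j)) addr0 => e.
  have zk : z ^+ weight (target_conf i j) != 0 by rewrite expf_neq0 ?z_neq0.
  apply: (mulIf zk); rewrite mul0r -[RHS]e mulr_suml; apply: eq_bigr => a _.
  rewrite mulr_suml; apply: eq_bigr => b _.
  by rewrite PsiE target_conf_loops target_conf_Nh target_conf_Nv mulrA.
move=> i; rewrite mem_cat => /orP[/allpairsP[p [_ _ ->]]|/mapP[C]]; first exact: kinl.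
rewrite mem_enum => cC ->; have := kE C; rewrite cC big1 ?add0r // => a _.
by rewrite big1 // => b _; rewrite kinl mul0r.
Qed.

Lemma kernel_dim : \dim (lker (hamiltonian zeta m n)) = 15%N.
Proof.
rewrite kernel_span; move/eqP: states_free => ->.
have s9 : size (Psi_states zeta m n) = (size (enum 'I_3) * size (enum 'I_3))%N.
  exact: size_allpairs.
by rewrite size_cat s9 size_enum_ord size_map -cardE card_crystals.
Qed.

Lemma kernel_ground_space :
  is_ground_space (hamiltonian zeta m n) (lker (hamiltonian zeta m n)).
Proof.
apply: psd_ground_space; last exact: hamiltonian_ge0.
by rewrite -dimv_eq0 kernel_dim.
Qed.

End Kernel.

End Torus.

Theorem mainTheorem4 (R : realType) (zeta : R) (zeta_gt0 : 0 < zeta) :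
  exists N : nat, forall m n : nat, (N <= m)%N -> (N <= n)%N ->
    let H := hamiltonian zeta m n in
    (is_ground_space H (lker H)
     /\ lker H = <<Psi_states zeta m n ++ crystal_states R m n>>%VS
     /\ #|crystals m n| = 6%N
     /\ \dim (lker H) = 15%N)
    /\
    ((forall C L : config m n, C \in crystals m n ->
        one_hexagon_move C L -> L = C)
     /\
     (forall L L' : config m n,
        L \in loops m n -> L \notin crystals m n ->
        L' \in loops m n -> L' \notin crystals m n ->
        Nh L = Nh L' -> Nv L = Nv L' ->
        connect (@one_hexagon_move m n) L L')).
Proof.
(* With both sides above 20, sites whose coordinates differ by at most 20 are distinct on the torus,
   which covers all local arguments. *)
exists 21%N => m n m_gt n_gt H; split; split.
- exact: kernel_ground_space.
- split; first exact: kernel_span.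
  by split; [exact: card_crystals|exact: kernel_dim].
- exact: crystal_isolated.
- exact: connect_noncrystals.
Qed.
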